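(* There is a universal constant $c>0$ (independent of $n$ and $f$) such that for every $n\ge1$ and every Lipschitz function $f$ on $\mathbb{R}^n$, $$\|f\|_{L_{\log^{1/2}}(\infty,\infty)(\mathbb{R}^n,d\gamma_n)}\le c\,\|\nabla f\|_{L^\infty(\mathbb{R}^n,d\gamma_n)}.$$ Moreover, for every $n\ge 1$, $$L_{\log^{1/2}}(\infty,\infty)(\mathbb{R}^n,d\gamma_n)\subset e^{L^2}(\mathbb{R}^n,d\gamma_n).$$
   Context: $\gamma_n$ is the Gaussian probability measure on $\mathbb{R}^n$, $d\gamma_n(x)=(2\pi)^{-n/2}e^{-|x|^2/2}dx$. For measurable $f:\mathbb{R}^n\to\mathbb{R}$, $f^{*}(s)=\inf\{t\ge0:\gamma_n(\{|f|>t\})\le s\}$, $s\in(0,1]$, and $f^{**}(t)=\frac1t\int_0^tf^{*}(s)\,ds$. The space $L_{\log^{1/2}}(\infty,\infty)(\mathbb{R}^n,d\gamma_n)$ consists of all $f\in L^1(\mathbb{R}^n,\gamma_n)$ such that $$\|f\|_{L_{\log^{1/2}}(\infty,\infty)(\mathbb{R}^n,d\gamma_n)}=\sup_{0<t<1}\big(f^{**}(t)-f^{*}(t)\big)\Big(\log\frac1t\Big)^{1/2}<\infty$$ (this quantity is not necessarily a norm). The space $e^{L^2}(\mathbb{R}^n,d\gamma_n)$ consists of all measurable $f$ for which there is $\lambda>0$ with $\int_{\mathbb{R}^n}e^{\lambda f(x)^2}\,d\gamma_n(x)<\infty$. The inclusion is an inclusion of sets. *)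

(* Defs.v *)
From HB Require Import structures.
From mathcomp Require Import all_boot all_order all_algebra.
From mathcomp Require Import all_classical all_reals all_analysis.
From mathcomp Require Import measurable_realfun.
From mathcomp Require Import ring lra.

Set Implicit Arguments.
Unset Strict Implicit.
Unset Printing Implicit Defensive.

Import Order.TTheory GRing.Theory Num.Theory.
Import numFieldNormedType.Exports.

Local Open Scope classical_set_scope.
Local Open Scope ring_scope.

(* R^n is 'rV[R]_n, with the product sigma-algebra, generated by the n
   coordinate functions; it is the Borel sigma-algebra of R^n. *)
Definition row_display : measure_display.
Proof. exact: default_measure_display. Qed.

Section measurable_row.
Context {R : realType} (n : nat).

Let coord_row : 'I_n -> 'rV[R]_n -> R := fun i x => x 0 i.

Let row_set0 : g_sigma_preimage coord_row set0.
Proof. exact: sigma_algebra0. Qed.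

Let row_setC A : g_sigma_preimage coord_row A ->
  g_sigma_preimage coord_row (~` A).
Proof. exact: sigma_algebraC. Qed.

Let row_bigcup (F : (set 'rV[R]_n)^nat) :
  (forall i, g_sigma_preimage coord_row (F i)) ->
  g_sigma_preimage coord_row (\bigcup_i (F i)).
Proof. exact: sigma_algebra_bigcup. Qed.

HB.instance Definition _ := @isMeasurable.Build row_display
  'rV[R]_n (g_sigma_preimage coord_row) row_set0 row_setC row_bigcup.

End measurable_row.

Lemma measurable_coord_row (R : realType) n (i : 'I_n) :
  measurable_fun [set: 'rV[R]_n] (fun x => x 0 i).
Proof.
move=> _ Y mY; rewrite setTI; apply: sub_sigma_algebra => /=.
rewrite -bigcup_seq/=; exists i => /=; first by rewrite mem_index_enum.
by exists Y => //; rewrite setTI.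
Qed.

Lemma measurable_fun_rowP d (T : measurableType d) (R : realType) n
    (f : T -> 'rV[R]_n) :
  measurable_fun [set: T] f <->
  forall i, measurable_fun [set: T] (fun x => f x 0 i).
Proof.
apply: (@iff_trans _ (g_sigma_preimage
    (fun i => (fun x : 'rV[R]_n => x 0 i) \o f) `<=` measurable)).
  rewrite g_sigma_preimage_comp; split=> [mf A [/= C preC <-]|prefS].
    exact: mf.
  by move=> _ A mA; apply: prefS; exists A.
split=> [tnthfS i|mf].
- move=> _ A mA.
  apply: tnthfS; apply: sub_sigma_algebra => /=.
  rewrite -bigcup_seq/=; exists i => /=; first by rewrite mem_index_enum.
  by exists A.
- apply: smallest_sub; first exact: sigma_algebra_measurable.
  rewrite -bigcup_seq/=; apply: bigcup_sub => i Ii.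
  by move=> A [B mB <-]; exact: mf.
Qed.

(* 'rV[R]_0 is a point, which carries unit mass, and lebesgue_row n.+1 is the
   image of the product measure on R * R^n by (a, v) |-> (a, v_0, .., v_(n-1)). *)
Definition cons_row (R : realType) n (p : measurableTypeR R * 'rV[R]_n) :
  'rV[R]_n.+1 := row_mx (p.1%:M : 'rV_1) p.2.

Fixpoint lebesgue_row (R : realType) n : set 'rV[R]_n -> \bar R :=
  if n is m.+1 return set 'rV[R]_n -> \bar R then
    pushforward (lebesgue_measure \x @lebesgue_row R m)%E (@cons_row R m)
  else \d_(0 : 'rV[R]_0).

Lemma cons_row0 (R : realType) n p : @cons_row R n p 0 0 = p.1.
Proof. by rewrite mxE; case: splitP => // j _; rewrite ord1 mxE mulr1n. Qed.

Lemma cons_rowS (R : realType) n p i :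
  @cons_row R n p 0 (lift ord0 i) = p.2 0 i.
Proof.
rewrite mxE; case: splitP => [[[]]//|j /= ij].
by congr (p.2 _ _); apply/val_inj; move: ij => [].
Qed.

Lemma measurable_cons_row (R : realType) n :
  measurable_fun [set: measurableTypeR R * 'rV[R]_n] (@cons_row R n).
Proof.
apply/measurable_fun_rowP => i; have [j ->|->] := unliftP ord0 i.
  under eq_fun do rewrite cons_rowS.
  apply: (measurableT_comp (measurable_coord_row _)).
  exact: measurable_snd.
under eq_fun do rewrite cons_row0.
exact: measurable_fst.
Qed.

Definition uncons_row (R : realType) n (x : 'rV[R]_n.+1) :
  measurableTypeR R * 'rV[R]_n := (x 0 0, \row_i x 0 (lift ord0 i)).

Lemma cons_rowK (R : realType) n : cancel (@cons_row R n) (@uncons_row R n).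
Proof.
move=> [a v]; rewrite /uncons_row cons_row0; congr pair.
by apply/rowP => i; rewrite mxE cons_rowS.
Qed.

Lemma uncons_rowK (R : realType) n : cancel (@uncons_row R n) (@cons_row R n).
Proof.
move=> x; apply/rowP => i; have [j ->|->] := unliftP ord0 i.
  by rewrite cons_rowS mxE.
by rewrite cons_row0.
Qed.

Lemma measurable_uncons_row (R : realType) n :
  measurable_fun [set: 'rV[R]_n.+1] (@uncons_row R n).
Proof.
apply/measurable_fun_pairP; split; first exact: measurable_coord_row.
apply/measurable_fun_rowP => i /=.
under eq_fun do rewrite /= mxE.
exact: measurable_coord_row.
Qed.

Section sigma_finite_pack.
Context d (T : measurableType d) (R : realType).
Variable m : {measure set T -> \bar R}.
Hypothesis sm : sigma_finite setT m.

Let m' : set T -> \bar R := m.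
HB.instance Definition _ := Measure.on m'.
HB.instance Definition _ := Measure_isSigmaFinite.Build _ _ _ m' sm.

Lemma sigma_finite_pack :
  exists mu : {sigma_finite_measure set T -> \bar R},
    m = mu :> (set T -> \bar R).
Proof. by exists m'. Qed.

End sigma_finite_pack.

Section lebesgue_row_measure.
Local Open Scope ereal_scope.
Context {R : realType}.

Let lebesgue_row_ex n :
  exists mu : {sigma_finite_measure set 'rV[R]_n -> \bar R},
  @lebesgue_row R n = mu.
Proof.
elim: n => [|n [mu muE]]; first by exists \d_(0%R : 'rV[R]_0).
rewrite /= muE.
pose m : {measure set 'rV[R]_n.+1 -> \bar R} :=
  measure_function_pushforward__canonical__measure_function_Measure
    (lebesgue_measure \x mu) (@measurable_cons_row R n).
apply: (sigma_finite_pack (m := m)).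
have /sigma_finiteP[F [TF ndF Foo]] :=
  sigma_finiteT (@lebesgue_measure R : set (measurableTypeR R) -> \bar R).
have /sigma_finiteP[G [TG ndG Goo]] := sigma_finiteT mu.
exists (fun k => @uncons_row R n @^-1` (F k `*` G k)).
  rewrite -preimage_bigcup (_ : \bigcup_k _ = setT) ?preimage_setT//.
  apply/seteqP; split => // -[x y] _.
  have [k _ Fkx] : (\bigcup_k F k) x by rewrite -TF.
  have [l _ Gly] : (\bigcup_k G k) y by rewrite -TG.
  exists (maxn k l) => //; split.
  - by move: x Fkx; exact/subsetPset/ndF/leq_maxl.
  - by move: y Gly; exact/subsetPset/ndG/leq_maxr.
move=> k; have [mF Fk] := Foo k; have [mG Gk] := Goo k; split.
  rewrite -[X in measurable X]setTI.
  by apply: measurable_uncons_row => //; exact: measurableX.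
rewrite /= /pushforward -comp_preimage (_ : _ \o _ = id).
  by rewrite preimage_id product_measure1E// lte_mul_pinfty// ge0_fin_numE.
by apply/funext => x /=; rewrite cons_rowK.
Qed.

Variable n : nat.
Local Notation mu := (@lebesgue_row R n).

Let lebesgue_row0 : mu set0 = 0.
Proof. by have [m ->] := lebesgue_row_ex n; exact: measure0. Qed.

Let lebesgue_row_ge0 A : 0 <= mu A.
Proof. by have [m ->] := lebesgue_row_ex n; exact: measure_ge0. Qed.

Let lebesgue_row_sigma_additive : semi_sigma_additive mu.
Proof.
by have [m ->] := lebesgue_row_ex n; exact: measure_semi_sigma_additive.
Qed.

HB.instance Definition _ := isMeasure.Build _ _ _ mu
  lebesgue_row0 lebesgue_row_ge0 lebesgue_row_sigma_additive.

Let lebesgue_row_sigma_finite : sigma_finite setT mu.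
Proof. by have [m ->] := lebesgue_row_ex n; exact: sigma_finiteT. Qed.

HB.instance Definition _ := Measure_isSigmaFinite.Build _ _ _ mu
  lebesgue_row_sigma_finite.

End lebesgue_row_measure.

Section gaussian_measure.
Context {R : realType}.

(* The library norm on 'rV[R]_n is the max norm. *)
Definition enorm n (x : 'rV[R]_n) : R := Num.sqrt (\sum_(i < n) x 0 i ^+ 2).

Lemma measurable_enorm n : measurable_fun [set: 'rV[R]_n] (@enorm n).
Proof.
apply: (measurableT_comp (continuous_measurable_fun (@sqrt_continuous R))).
apply: (@measurable_sum _ _ R _ _ _ (fun i (x : 'rV[R]_n) => x 0 i ^+ 2)) => i.
by apply: measurable_funX; exact: measurable_coord_row.
Qed.

Definition gauss_pdf n (x : 'rV[R]_n) : R :=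
  (pi *+ 2) `^ (- (n%:R / 2)) * expR (- (enorm x ^+ 2 / 2)).

Lemma gauss_pdf_ge0 n (x : 'rV[R]_n) : 0 <= gauss_pdf x.
Proof. by rewrite mulr_ge0// ?powR_ge0 ?expR_ge0. Qed.

Lemma measurable_gauss_pdf n : measurable_fun [set: 'rV[R]_n] (@gauss_pdf n).
Proof.
apply: measurable_funM => //; apply: measurableT_comp => //.
apply: measurableT_comp => //; apply: measurable_funM => //.
by apply: measurable_funX; exact: measurable_enorm.
Qed.

Definition gaussian n (A : set 'rV[R]_n) : \bar R :=
  (\int[@lebesgue_row R n]_(x in A) (gauss_pdf x)%:E)%E.

Lemma gauss_pdf_cons n (x : R) (v : 'rV[R]_n) :
  gauss_pdf (cons_row (x, v)) = normal_pdf 0 1 x * gauss_pdf v.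
Proof.
rewrite normal_pdfE ?oner_neq0// /normal_peak /normal_fun.
have pi0 := pi_ge0 R.
rewrite expr1n mul1r subr0 -powR12_sqrt; last by rewrite mulrn_wge0.
rewrite -powRN mulrACA -expRD -powRD; last first.
  by apply/implyP => _; rewrite mulrn_eq0/= gt_eqF// pi_gt0.
rewrite /gauss_pdf /enorm !sqr_sqrtr; last 2 first.
- by apply: sumr_ge0 => i _; exact: sqr_ge0.
- by apply: sumr_ge0 => i _; exact: sqr_ge0.
rewrite big_ord_recl cons_row0; under eq_bigr do rewrite cons_rowS.
by rewrite -natr1/=; congr (_ `^ _ * expR _); field.
Qed.

Lemma gauss_setT n : @gaussian n setT = 1%E.
Proof.
have mE m : measurable_fun setT (fun x : 'rV[R]_m => (gauss_pdf x)%:E).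
  by apply/measurable_EFinP; exact: measurable_gauss_pdf.
rewrite /gaussian; elim: n => [|n IHn].
  rewrite (integral_dirac (0 : 'rV[R]_0) measurableT (mE 0%N)) diracT mul1e.
  rewrite /gauss_pdf /enorm big_ord0 sqrtr0.
  by rewrite expr0n/= !mul0r oppr0 powRr0 expR0 mulr1.
have mg := @measurable_gauss_pdf n.+1.
rewrite (@ge0_integral_pushforward _ _ _ _ R _ (@measurable_cons_row R n)
  (lebesgue_measure \x @lebesgue_row R n)%E setT (fun x => (gauss_pdf x)%:E))//=;
  first last.
- by move=> x _; rewrite lee_fin gauss_pdf_ge0.
- exact/measurable_EFinP.
rewrite preimage_setT fubini_tonelli1/=; first last.
- by move=> x; rewrite lee_fin gauss_pdf_ge0.
- apply/measurable_EFinP; apply: (measurableT_comp mg).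
  exact: measurable_cons_row.
rewrite -[RHS](@integral_normal_pdf R 0 1).
apply: eq_integral => x _; rewrite /fubini_F.
under eq_integral do rewrite /= gauss_pdf_cons EFinM.
rewrite ge0_integralZl//= ?IHn ?mule1//.
- by apply/measurable_EFinP; exact: measurable_gauss_pdf.
- by move=> y _; rewrite lee_fin gauss_pdf_ge0.
- by rewrite lee_fin normal_pdf_ge0.
Qed.

Variable n : nat.
Local Notation gamma := (@gaussian n).

Let gauss0 : gamma set0 = 0%E.
Proof. exact: integral_set0. Qed.

Let gauss_ge0 A : (0 <= gamma A)%E.
Proof. by apply: integral_ge0 => x _; rewrite lee_fin gauss_pdf_ge0. Qed.

Let gauss_sigma_additive : semi_sigma_additive gamma.
Proof.
move=> /= A mA tA mUA; rewrite /gaussian ge0_integral_bigcup//=.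
- apply: is_cvg_ereal_nneg_natsum_cond => k _ _.
  by apply: integral_ge0 => x _; rewrite lee_fin gauss_pdf_ge0.
- apply: measurable_funTS; apply/measurable_EFinP.
  exact: measurable_gauss_pdf.
- by move=> x _; rewrite lee_fin gauss_pdf_ge0.
Qed.

HB.instance Definition _ := isMeasure.Build _ _ _ gamma
  gauss0 gauss_ge0 gauss_sigma_additive.

HB.instance Definition _ := Measure_isProbability.Build _ _ _ gamma
  (gauss_setT n).

End gaussian_measure.

Section function_spaces.
Context {R : realType} {n : nat}.
Local Notation gamma := (@gaussian R n).
Implicit Types f : 'rV[R]_n -> R.

(* f^*. For measurable f and 0 < s the set is nonempty (gamma is finite), so
   inf is a true infimum. *)
Definition rearr f (s : R) : R :=
  inf [set t : R | 0 <= t /\ (gamma [set x | (t < `|f x|)%R] <= s%:E)%E].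

(* f^**, extended-real valued: it is +oo when f^* is not integrable near 0. *)
Definition rearr_avg f (t : R) : \bar R :=
  ((t^-1)%:E * \int[lebesgue_measure]_(s in `]0%R, t[) (rearr f s)%:E)%E.

Definition norm_Llog f : \bar R :=
  ereal_sup [set ((rearr_avg f t - (rearr f t)%:E)
                  * (Num.sqrt (ln (1 / t)))%:E)%E | t in `]0, 1[ ].

Definition Llog : set ('rV[R]_n -> R) :=
  [set f : 'rV[R]_n -> R | gamma.-integrable setT (EFin \o f) /\
           (norm_Llog f < +oo)%E].

Definition expL2 : set ('rV[R]_n -> R) :=
  [set f : 'rV[R]_n -> R | measurable_fun setT f /\
    exists2 lam : R, 0 < lam &
      (\int[gamma]_x (expR (lam * f x ^+ 2))%:E < +oo)%E].

(* Lipschitz for the Euclidean norm. *)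
Definition elipschitz f : Prop :=
  exists K : R, forall x y, `|f x - f y| <= K * enorm (x - y).

(* 'D_v is a total operator; for Lipschitz f it is the true directional
   derivative outside a null set (Rademacher). *)
Definition gradient f (x : 'rV[R]_n) : 'rV[R]_n :=
  \row_i 'D_(delta_mx 0 i) f x.

Definition grad_Linfty f : \bar R :=
  ('N[gamma]_+oo [(fun x => (enorm (gradient f x))%:E)])%E.

End function_spaces.

(* Main.v *)
Require Import Defs.
From HB Require Import structures.
From mathcomp Require Import all_boot all_order all_algebra.
From mathcomp Require Import all_classical all_reals all_analysis.
From mathcomp Require Import measurable_realfun ess_sup_inf.
From mathcomp Require Import ring lra.

(** The Gaussian logarithmic Sobolev inequality is used in its dual form:
    [E (g^2 h) <= 2 E |grad g|^2] whenever [E e^h <= 1].  On the line it follows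
    from the monotone transport of [e^h] times the Gaussian density to the
    Gaussian density, by an integration by parts; in this form it tensorizes at
    once.  Take [g] to be the truncation [min (|f| - a)_+ N] with [a] slightly
    above [f^*(t)], and [h] equal to [ln (1/t) / 2] where [g > 0].  Since [g > 0]
    on a set of measure at most [t], this gives
    [E g^2 <= 4 M^2 t / ln (1/t)] if [|grad f| <= M].  Chebyshev's inequality then
    bounds [f^*(s) - f^*(t)] by [sqrt (E g^2 / s)], and averaging over [s < t]
    yields the first claim with [c = 4].  Only the partial derivatives of a
    Lipschitz function are needed, so Lebesgue's theorem on each coordinate line
    replaces Rademacher's theorem.

    For the inclusion, the bound on [f^** - f^*] gives
    [f^**(t/2) <= f^**(t) + O(ln (1/t) ^ (-1/2))]; summing over dyadic [t] shows
    [f^*(2^-k) = O(sqrt k)], that is, a Gaussian tail for [f]. *)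

Set Implicit Arguments.
Unset Strict Implicit.
Unset Printing Implicit Defensive.

Import Order.TTheory GRing.Theory Num.Theory.
Import numFieldNormedType.Exports.

Local Open Scope classical_set_scope.
Local Open Scope ring_scope.

(** * Lipschitz functions on the line *)

(** The transport is confined to an interval [[-b, b]], where the normal density is bounded below.
    The monotone map is then Lipschitz, and the integration by parts reduces to the fundamental
    theorem of calculus for Lipschitz functions, whose boundary terms vanish because the map fixes
    both endpoints; [b] tends to infinity only afterwards.

    In the tensorization, derivatives are averaged over all slices, including those where they fail
    to exist. They are therefore replaced by [dini], which is total, measurable and bounded by the
    Lipschitz constant. Since the truncation is bounded too, every function involved is bounded and
    measurable, and Fubini's theorem always applies. Genuine partial derivatives return only at the
    end, almost everywhere, to compare the truncation with [f].

    The constant [4] is [2 * 2]. The factor [2] in the dual inequality, against a test function of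
    height [ln (1/t) / 2], gives the [4] in the bound on [E g^2], hence a [2] after the square root;
    averaging [s^(-1/2)] over []0, t[] gives the other [2]. *)

Section finite_measure_pack.
Context d (T : measurableType d) (R : realType).
Variable m : {measure set T -> \bar R}.
Hypothesis mT : (m setT < +oo)%E.

Let m' : set T -> \bar R := m.
HB.instance Definition _ := Measure.on m'.

Let fin_num_m' : fin_num_fun m'.
Proof.
by move=> A mA; rewrite ge0_fin_numE// (le_lt_trans _ mT)// le_measure// inE.
Qed.

HB.instance Definition _ := Measure_isFinite.Build _ _ _ m' fin_num_m'.

Lemma finite_measure_pack :
  exists nu : {finite_measure set T -> \bar R}, nu = m :> (set T -> \bar R).
Proof. by exists m'. Qed.

End finite_measure_pack.

Section lipschitz_real.
Context {R : realType}.
Notation mu := (@lebesgue_measure R).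

Lemma lebesgue_stieltjes_itvoc (G : cumulative R R) (x y : R) : x <= y ->
  lebesgue_stieltjes_measure G `]x, y]%classic = (G y - G x)%:E.
Proof.
move=> xy; rewrite /lebesgue_stieltjes_measure /= /measure_extension.
rewrite measurable_mu_extE/=; last exact: is_ocitv.
by rewrite wlength_itv_bnd.
Qed.

Lemma lipschitz_continuous (f : R -> R) (K : R) :
  (forall x y, `|f x - f y| <= K * `|x - y|) -> continuous f.
Proof.
move=> fK x; apply/cvgrPdist_le => /= e e0.
have K0 : 0 <= K by have := fK 0 1; rewrite sub0r normrN normr1 mulr1; apply: le_trans.
near=> y; rewrite (le_trans (fK _ _))// (@le_trans _ _ ((K + 1) * `|x - y|))//.
  by rewrite ler_wpM2r// lerDl.
rewrite -ler_pdivlMl ?ltr_wpDl//.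
near: y; exists ((K + 1)^-1 * e) => /=.
  by rewrite mulr_gt0// invr_gt0 ltr_wpDl.
by move=> z /ltW.
Unshelve. all: by end_near. Qed.

Definition clamp (a b x : R) : R := Num.max a (Num.min b x).

Lemma clamp_lipschitz a b x y : `|clamp a b x - clamp a b y| <= `|x - y|.
Proof.
rewrite /clamp /Num.max /Num.min.
wlog xy : x y / x <= y => [wl|].
  by have [/wl//|/ltW/wl] := leP x y; rewrite distrC (distrC x).
rewrite distrC (distrC x) (ger0_norm (_ : 0 <= y - x)) ?subr_ge0// ler_norml.
by repeat case: ifPn; rewrite -?leNgt => *; apply/andP; split; lra.
Qed.

Lemma clampE a b x : a <= x <= b -> clamp a b x = x.
Proof. by move=> /andP[ax xb]; rewrite /clamp min_r// max_r. Qed.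

Lemma clamp_itv a b x : a <= b -> a <= clamp a b x <= b.
Proof.
by move=> ab; rewrite /clamp le_max lexx/= ge_max ab/= ge_min lexx.
Qed.

Lemma nondecreasing_clamp a b : {homo clamp a b : x y / x <= y}.
Proof.
by move=> x y xy; rewrite /clamp /Num.max /Num.min; repeat case: ifPn; rewrite -?leNgt => *; lra.
Qed.

Lemma continuous_clamp a b : continuous (clamp a b).
Proof.
apply: (@lipschitz_continuous _ 1) => x y.
by rewrite mul1r clamp_lipschitz.
Qed.

(** Adding the slope [K] to a [K]-Lipschitz function makes it nondecreasing, hence the distribution
    function of a Stieltjes measure; clamping makes it constant outside [[a, b]], so that the
    measure is finite. *)
Lemma lipschitz_cumulative (f : R -> R) (K a b : R) : a <= b ->
  (forall x y, `|f x - f y| <= K * `|x - y|) ->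
  exists G : cumulative R R, G = (fun x => K * clamp a b x + f (clamp a b x)) :> (R -> R).
Proof.
move=> ab fK; pose G x := K * clamp a b x + f (clamp a b x).
have ndG : {homo G : x y / x <= y}.
  move=> x y /(nondecreasing_clamp a b); rewrite /G.
  set u := clamp a b x; set v := clamp a b y => uv.
  have := fK v u; rewrite (ger0_norm (_ : 0 <= v - u)) ?subr_ge0//.
  by rewrite ler_norml => /andP[+ _]; lra.
have cG : continuous G.
  move=> x; apply: cvgD; [apply: cvgMr; exact: continuous_clamp|].
  apply: (@continuous_comp _ _ _ (clamp a b) f); first exact: continuous_clamp.
  exact: (lipschitz_continuous fK).
have rcG : right_continuous G by exact: right_continuousW.
pose isC := isCumulative.Build R _ R G ndG rcG.
pose Gc : cumulative R R := HB.pack G isC.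
by exists Gc.
Qed.

Lemma lebesgue_measure_itvoc_clamp (a b x y : R) : a <= b -> x <= y ->
  mu (`]x, y]%classic `&` `]a, b]%classic) = (clamp a b y - clamp a b x)%:E.
Proof.
move=> ab xy.
have -> : `]x, y]%classic `&` `]a, b]%classic = `]Num.max x a, Num.min y b]%classic :> set R.
  apply/seteqP; split => z /=; rewrite !in_itv/= gt_max le_min.
    by move=> [/andP[-> ->] /andP[-> ->]].
  by move=> /andP[/andP[-> ->] /andP[-> ->]].
rewrite lebesgue_measure_itv/= lte_fin /clamp /Num.max /Num.min.
by repeat case: ifPn; rewrite -?leNgt => *; rewrite -?EFinD; congr EFin; lra.
Qed.

(** The measures of [K x + f] and [K x - f] add up to [2 K] times Lebesgue measure on []a, b]], so
    each of them is dominated by it. This gives absolute continuity without an epsilon-delta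
    argument. *)
Lemma lipschitz_stieltjes_dominated (f : R -> R) (K a b : R) : a <= b ->
  (forall x y, `|f x - f y| <= K * `|x - y|) ->
  exists nu : {finite_measure set (measurableTypeR R) -> \bar R},
    (nu `<< mu) /\ forall x, a <= x <= b ->
    nu `]a, x]%classic = (K * (x - a) + (f x - f a))%:E.
Proof.
move=> ab fK.
have K0 : 0 <= K by have := fK 0 1; rewrite sub0r normrN normr1 mulr1; apply: le_trans.
have [G1 G1E] := lipschitz_cumulative ab fK.
have [|G2 G2E] := @lipschitz_cumulative (- f) K a b ab.
  by move=> x y; rewrite !fctE -opprD normrN.
(* The sum of the two measures and [2 K] times Lebesgue measure are both identified with the
   Stieltjes measure of [G3], by agreement on half-open intervals. *)
have [|G3 G3E] := @lipschitz_cumulative (cst 0) (K *+ 2) a b ab.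
  by move=> x y; rewrite subrr normr0 mulr_ge0// mulrn_wge0.
have K20 : 0 <= K *+ 2 by rewrite mulrn_wge0.
pose kappa : {measure set (measurableTypeR R) -> \bar R} :=
  mscale (NngNum K20) (mrestr mu (measurable_itv `]a, b])).
pose nu12 : {measure set (measurableTypeR R) -> \bar R} :=
  measure_add (lebesgue_stieltjes_measure G1) (lebesgue_stieltjes_measure G2).
have nu12E A : nu12 A = (lebesgue_stieltjes_measure G1 A + lebesgue_stieltjes_measure G2 A)%E.
  exact: measure_addE.
have E1 A : measurable A -> lebesgue_stieltjes_measure G3 A = nu12 A.
  apply: lebesgue_stieltjes_measure_unique => X /ocitvP[->|]; first by rewrite !measure0.
  move=> [[x y]/= xy ->]; rewrite nu12E !lebesgue_stieltjes_itvoc ?ltW//.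
  by rewrite G1E G2E G3E !fctE -EFinD; congr EFin; ring.
have E2 A : measurable A -> lebesgue_stieltjes_measure G3 A = kappa A.
  apply: lebesgue_stieltjes_measure_unique => X /ocitvP[->|]; first by rewrite !measure0.
  move=> [[x y]/= xy ->]; rewrite lebesgue_stieltjes_itvoc ?ltW// /kappa /= /mscale /= /mrestr.
  rewrite lebesgue_measure_itvoc_clamp ?(ltW xy)// G3E.
  by rewrite [RHS](_ : _ = (K *+ 2 * (clamp a b y - clamp a b x))%:E)//; congr EFin; rewrite !fctE; ring.
have le_nu1 A : measurable A -> (lebesgue_stieltjes_measure G1 A <= kappa A)%E.
  move=> mA; rewrite -E2// E1// nu12E.
  by rewrite leeDl// measure_ge0.
have [|nu nuE] := @finite_measure_pack _ _ _ (lebesgue_stieltjes_measure G1).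
  rewrite (le_lt_trans (le_nu1 _ measurableT))//= /mscale /= /mrestr setTI.
  by rewrite lebesgue_measure_itv/= lte_fin; case: ifPn => _; rewrite -?EFinD -?EFinM ?mule0 ltry.
exists nu; split.
  apply/null_content_dominatesP => A mA A0.
  apply/eqP; rewrite nuE -measure_le0 (le_trans (le_nu1 _ mA))//=.
  rewrite /mscale /= /mrestr (_ : mu _ = 0%E) ?mule0//.
  by apply: (subset_measure0 _ _ _ A0) => //; exact: measurableI.
move=> x /andP[ax xb].
apply: (etrans (congr1 (fun m : set R -> \bar R => m _) nuE)).
apply: (etrans (lebesgue_stieltjes_itvoc G1 ax)); rewrite G1E !clampE ?lexx ?ab ?ax//.
by congr EFin; ring.
Qed.

Lemma lipschitz_density (f : R -> R) (K a b : R) : a <= b ->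
  (forall x y, `|f x - f y| <= K * `|x - y|) ->
  exists2 h : R -> R, mu.-integrable setT (EFin \o h) &
    forall x, a <= x <= b ->
    (\int[mu]_(y in `[a, x]) (h y)%:E = (K * (x - a) + (f x - f a))%:E)%E.
Proof.
move=> ab fK; have [nu [nu_mu nuE]] := lipschitz_stieltjes_dominated ab fK.
have [h [h0 hfin hint hE]] := radon_nikodym_sigma_finite nu_mu.
have hfine : EFin \o (fine \o h) = h by apply/funext => x /=; rewrite fineK.
exists (fine \o h) => [|x /andP[ax xb]]; first by rewrite hfine.
under eq_integral do rewrite /= fineK//.
rewrite -integral_itv_obnd_cbnd; last first.
  by apply: (measurable_funS measurableT) => //; apply: measurable_int hint.
by rewrite -nuE ?ax// hE.
Qed.

Lemma bounded_integrable_itv (f : R -> R) (B a b : R) :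
  measurable_fun `[a, b] f -> (forall x, x \in `[a, b] -> `|f x| <= B) ->
  mu.-integrable `[a, b] (EFin \o f).
Proof.
move=> mf fB; apply: measurable_bounded_integrable => //.
  rewrite /= lebesgue_measure_itv/=; case: ifP => _; by rewrite -?EFinD ltry.
exists B; split; first exact: num_real.
by move=> M BM x /= xab; rewrite (le_trans _ (ltW BM))// fB.
Qed.

(** Subtracting [K] from the Radon-Nikodym density of [K x + f] leaves a density whose primitive is
    [f]; Lebesgue's differentiation theorem then identifies it with the derivative almost
    everywhere. It is cut off outside [[a, b]] to be integrable on the line. *)
Lemma lipschitz_FTC (f : R -> R) (K a b : R) : a < b ->
  (forall x y, `|f x - f y| <= K * `|x - y|) ->
  exists d : R -> R, [/\ mu.-integrable setT (EFin \o d),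
    {ae mu, forall x, a < x < b -> is_derive x (1 : R) f (d x)} &
    (\int[mu]_(x in `[a, b]) (d x)%:E = (f b - f a)%:E)%E].
Proof.
move=> ab fK; have [h hint hE] := lipschitz_density (ltW ab) fK.
pose d0 x := h x - K.
have iK u v : mu.-integrable `[u, v] (EFin \o cst K).
  by apply: (@bounded_integrable_itv _ `|K|).
have ih u v : mu.-integrable `[u, v] (EFin \o h).
  exact: (integrableS measurableT).
have id0 u v : mu.-integrable `[u, v] (EFin \o d0).
  rewrite /d0 (_ : EFin \o _ = ((EFin \o h) \- (EFin \o cst K))%E)//.
  exact: integrableB.
pose d : R -> R := d0 \_ `[a, b].
have iab : mu.-integrable setT (EFin \o d).
  rewrite /d -restrict_EFin; apply/integrable_restrict => //; rewrite setTI; exact: id0.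
have dE x : a <= x <= b -> (\int[mu]_(y in `[a, x]) (d y)%:E = (f x - f a)%:E)%E.
  move=> /andP[ax xb]; transitivity (\int[mu]_(y in `[a, x]) (d0 y)%:E)%E.
    apply: eq_integral => y; rewrite inE /= in_itv/= => /andP[ay yx].
    by rewrite /d patchE mem_set//= in_itv/= ay (le_trans yx).
  rewrite /d0; under eq_integral do rewrite EFinB.
  rewrite integralB//= ?hE ?ax//; try exact: ih; try exact: iK.
  rewrite integral_cst//= lebesgue_measure_itv/= lte_fin.
  case: ifPn => [_|]; first by
    transitivity (K * (x - a) + (f x - f a) - K * (x - a))%:E => //; congr EFin; ring.
  rewrite -leNgt => xa; have -> : x = a by apply/eqP; rewrite eq_le ax xa.
  by rewrite mule0 sube0; congr EFin; ring.
exists d; split => //; last by rewrite dE// lexx ltW.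
have Fint y : mu.-integrable [set` Interval (BLeft a) (BRight y)] (EFin \o d).
  exact: (integrableS measurableT).
have Floc : locally_integrable setT d by rewrite /d; exact: integrable_locally.
have := FTC1 Fint Floc; apply: filterS; first exact: (ae_filter_ringOfSetsType mu).
move=> x /= + /andP[ax xb]; rewrite lte_fin => /(_ ax)[dF Fd].
set F := (fun x : R => _) in dF Fd.
apply: (@near_eq_is_derive _ _ _ (F + cst (f a))).
  near=> y; rewrite !fctE /F /Rintegral dE/=; first by rewrite subrK.
  by apply/andP; split; apply/ltW; near: y; [exact: lt_nbhsr|exact: lt_nbhsl].
rewrite -[d x]addr0; apply: is_deriveD.
by rewrite -Fd derive1E; apply: DeriveDef.
Unshelve. all: by end_near. Qed.

Lemma lipschitz_ae_derivable (f : R -> R) (K : R) :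
  (forall x y, `|f x - f y| <= K * `|x - y|) ->
  {ae mu, forall x, derivable f x (1 : R)}.
Proof.
move=> fK; have : {ae mu, forall x, forall k : nat, (- (k.+1%:R : R) < x < k.+1%:R) ->
    derivable f x (1 : R)}.
  apply/ae_foralln => k; have [//|d [_ + _]] := @lipschitz_FTC f K (- k.+1%:R) k.+1%:R _ fK.
    by rewrite gtrN.
  apply: filterS; first exact: (ae_filter_ringOfSetsType mu).
  by move=> x /= + xk => /(_ xk) [].
apply: filterS; first exact: (ae_filter_ringOfSetsType mu).
move=> x /(_ (Num.truncn `|x|)); apply.
by rewrite -ltr_norml truncnS_gt.
Qed.

(** * Difference quotients along countably many steps *)

Definition dquot (V : lmodType R) (f : V -> R) (v x : V) (t : R) : R :=
  t^-1 * (f (x + t *: v) - f x).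

(* The upper right Dini derivative along [v], taken along the steps [1/(k+1)]
   only: measurable in [x], and the derivative whenever the latter exists. *)
Definition dini (V : lmodType R) (f : V -> R) (v x : V) : R :=
  fine (limn_esup (fun k => (dquot f v x k.+1%:R^-1)%:E)).

Lemma dquot_le (V : lmodType R) (f : V -> R) (v x : V) (K t : R) :
  (forall s, `|f (x + s *: v) - f x| <= K * `|s|) -> t != 0 -> `|dquot f v x t| <= K.
Proof.
by move=> fK t0; rewrite normrM normfV ler_pdivrMl ?normr_gt0// mulrC fK.
Qed.

Lemma limn_esup_le (u : (\bar R)^nat) (l : \bar R) :
  (forall n, u n <= l)%E -> (limn_esup u <= l)%E.
Proof.
move=> ul; rewrite limn_esup_lim; apply: lime_le; first exact: is_cvg_esups.
by apply: nearW => n; apply: ub_ereal_sup => _ [m /= nm <-].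
Qed.

Lemma le_limn_esup (u : (\bar R)^nat) (l : \bar R) :
  (forall n, l <= u n)%E -> (l <= limn_esup u)%E.
Proof.
move=> ul; rewrite limn_esup_lim; apply: lime_ge; first exact: is_cvg_esups.
apply: nearW => n; apply: le_trans (ul n) _.
by apply: ereal_sup_ubound; exists n => /=.
Qed.

Lemma limn_esup_bounded (u : R^nat) (K : R) : (forall n, `|u n| <= K) ->
  (- K%:E <= limn_esup (EFin \o u) <= K%:E)%E.
Proof.
move=> uK; apply/andP; split.
  by apply: le_limn_esup => n /=; rewrite lee_fin; have := uK n; rewrite ler_norml => /andP[].
by apply: limn_esup_le => n /=; rewrite lee_fin; have := uK n; rewrite ler_norml => /andP[].
Qed.

Lemma dini_le (V : lmodType R) (f : V -> R) (v x : V) (K : R) :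
  (forall s, `|f (x + s *: v) - f x| <= K * `|s|) -> `|dini f v x| <= K.
Proof.
move=> fK; have := @limn_esup_bounded (fun k => dquot f v x k.+1%:R^-1) K.
rewrite /dini; set l := limn_esup _ => /(_ _)/andP[|].
  by move=> n; exact: dquot_le.
case: l => [r||]//=; rewrite !lee_fin => lK Kl.
  by rewrite ler_norml lK Kl.
Qed.

Lemma cvg_dquot (V : normedModType R) (f : V -> R) (v x : V) (u : R^nat) :
  u @ \oo --> 0 -> (forall k, u k != 0) -> derivable f x v ->
  dquot f v x (u k) @[k --> \oo] --> 'D_v f x.
Proof.
move=> cu u0 df; have h0 : u @ \oo --> (0 : R)^'.
  move=> A A0; have := cu _ A0; rewrite /= !nbhs_simpl /=.
  by apply: filterS => k; apply; exact: u0.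
have := cvg_comp _ _ h0 df; apply: cvg_trans; apply: near_eq_cvg.
by apply: nearW => k /=; rewrite /dquot (addrC x).
Qed.

Lemma cvg_dquotr (V : normedModType R) (f : V -> R) (v x : V) : derivable f x v ->
  dquot f v x k.+1%:R^-1 @[k --> \oo] --> 'D_v f x.
Proof. by apply: cvg_dquot => [|k]; [exact: cvg_harmonic|rewrite invr_neq0]. Qed.

Lemma cvg_dquotl (V : normedModType R) (f : V -> R) (v x : V) : derivable f x v ->
  dquot f v x (- k.+1%:R^-1) @[k --> \oo] --> 'D_v f x.
Proof.
apply: cvg_dquot => [|k]; last by rewrite oppr_eq0 invr_neq0.
by rewrite -oppr0; apply: cvgN; exact: cvg_harmonic.
Qed.

Lemma dini_derive (V : normedModType R) (f : V -> R) (v x : V) (l : R) :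
  is_derive x v f l -> dini f v x = l.
Proof.
move=> [df <-]; rewrite /dini.
have /cvg_limn_einf_sup[_ ->]// : (dquot f v x k.+1%:R^-1)%:E @[k --> \oo] --> ('D_v f x)%:E.
by apply/fine_cvgP; split; [exact: nearW|exact: cvg_dquotr].
Qed.

Lemma limn_esup_einf_cvg (u : (\bar R)^nat) (l : \bar R) :
  limn_einf u = l -> limn_esup u = l -> u @ \oo --> l.
Proof.
rewrite limn_einf_lim limn_esup_lim => il sl.
apply: (@squeeze_cvge _ _ _ _ (einfs u) _ (esups u)).
- apply: nearW => n; apply/andP; split.
    by apply: ereal_inf_lbound; exists n => /=.
  by apply: ereal_sup_ubound; exists n => /=.
- by rewrite -il; exact: is_cvg_einfs.
- by rewrite -sl; exact: is_cvg_esups.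
Qed.

(** The ratio of consecutive steps [1/(k+1)] tends to [1], so every small [h] lies next to a step
    [t] of the same sign; for a Lipschitz [F], replacing [h] by [t] changes the quotient by at most
    [2 K / (k+1)]. *)
Lemma dquot_cvg (F : R -> R) (K L : R) :
  (forall s t, `|F s - F t| <= K * `|s - t|) ->
  k.+1%:R * (F k.+1%:R^-1 - F 0) @[k --> \oo] --> L ->
  - k.+1%:R * (F (- k.+1%:R^-1) - F 0) @[k --> \oo] --> L ->
  h^-1 * (F h - F 0) @[h --> 0^'] --> L.
Proof.
move=> FK rL lL.
have K0 : 0 <= K by have := FK 0 1; rewrite sub0r normrN normr1 mulr1; apply: le_trans.
apply/cvgrPdist_le => /= e e0.
have e20 : 0 < e / 2 by rewrite divr_gt0.
have [N1 _ rN] := (cvgrPdist_le _ _).1 rL _ e20.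
have [N2 _ lN] := (cvgrPdist_le _ _).1 lL _ e20.
pose N := maxn (maxn N1 N2) (Num.truncn (2 * K / (e / 2))).
exists (N.+2%:R^-1) => /=; first by rewrite invr_gt0.
move=> h; rewrite /= sub0r normrN => hN h0.
have ah : 0 < `|h| by rewrite normr_gt0.
have Nh : N.+2%:R < `|h|^-1 by rewrite -[ltLHS]invrK ltf_pV2// posrE invr_gt0.
pose j := Num.truncn (`|h|^-1).
have [jh hj] : j%:R <= `|h|^-1 /\ `|h|^-1 < j.+1%:R.
  by have /andP[] := truncn_itv (ltW (le_lt_trans (ler0n _ _) Nh)).
have Nj : (N.+2 <= j)%N by rewrite -ltnS -(ltr_nat R) (lt_trans Nh).
have [k jk] : exists k, j = k.+1 by exists j.-1; rewrite prednK// (leq_trans _ Nj).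
have Nk : (N < k)%N by rewrite -ltnS -jk.
pose t := Num.sg h * k.+1%:R^-1.
have tL : `|L - t^-1 * (F t - F 0)| <= e / 2.
  have [hp|hn] : h > 0 \/ h < 0 by case: (ltgtP h 0) h0 => // _ _; [right|left].
    rewrite /t gtr0_sg// mul1r invrK; apply: rN => /=.
    by rewrite (leq_trans _ (ltnW Nk))// (leq_trans _ (leq_maxl _ _))// leq_maxl.
  rewrite /t ltr0_sg// mulN1r invrN invrK; apply: lN => /=.
  by rewrite (leq_trans _ (ltnW Nk))// (leq_trans _ (leq_maxl _ _))// leq_maxr.
pose a : R := `|h|; rewrite -/a in ah Nh jh hj *.
have sE : h = Num.sg h * a by rewrite /a {1}(numEsg h).
have sg1 : `|Num.sg h| = 1 by rewrite normr_sg h0.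
pose tau : R := k.+1%:R^-1.
have tau0 : 0 < tau by rewrite invr_gt0.
have taua : a <= tau.
  by rewrite /tau -jk -[leLHS]invrK lef_pV2// posrE ?invr_gt0// jk.
have tah : `|t - h| = tau - a.
  by rewrite /t [X in _ - X]sE -mulrBr normrM sg1 mul1r ger0_norm// subr_ge0.
have at_ : `|t| = tau by rewrite /t normrM sg1 mul1r gtr0_norm.
have t0 : t != 0 by rewrite -normr_gt0 at_.
(* As [1/a < k + 2], the relative gap [tau / a - 1] is below [(k+2)/(k+1) - 1 = tau]. *)
have taE : (tau - a) / a <= tau.
  rewrite mulrBl divff ?gt_eqF// lerBlDr.
  rewrite -(ler_pM2l (_ : 0 < k.+1%:R))// mulrDr /tau mulrA mulfV ?pnatr_eq0// mul1r mulr1.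
  by rewrite -natr1 addrC in hj *; rewrite jk in hj; rewrite ltW// -[in ltRHS]natr1 addrC.
have Ktau : 2 * (K * tau) <= e / 2.
  have : 2 * K / (e / 2) <= k.+1%:R.
    apply/ltW/(lt_le_trans (truncnS_gt _)); rewrite ler_nat ltnS.
    by rewrite (leq_trans _ (ltnW Nk))// /N leq_maxr.
  rewrite ler_pdivrMr// => q.
  by rewrite [2 * (K * _)]mulrA /tau ler_pdivrMr ?ltr0Sn// (le_trans q)// mulrC.
have D1 : `|h^-1 * (F t - F h)| <= K * tau.
  rewrite normrM normfV -/a (le_trans (ler_wpM2l _ (FK t h))) ?invr_ge0 ?(ltW ah)//.
  by rewrite tah mulrCA ler_wpM2l// mulrC.
have D2 : `|(t^-1 - h^-1) * (F t - F 0)| <= K * tau.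
  have -> : t^-1 - h^-1 = - ((t - h) / (t * h)) by field; rewrite h0 t0.
  rewrite mulNr normrN normrM normf_div tah normrM at_ -/a.
  have F0 : `|F t - F 0| <= K * tau by rewrite -at_ -{2}(subr0 t) FK.
  have b0 : 0 <= (tau - a) / (tau * a) by rewrite divr_ge0 ?subr_ge0// mulr_ge0 ?ltW.
  rewrite (le_trans (ler_wpM2l b0 F0))//.
  rewrite [leLHS](_ : _ = K * ((tau - a) / a)); last by field; rewrite !gt_eqF.
  by rewrite ler_wpM2l.
have -> : L - h^-1 * (F h - F 0) = (L - t^-1 * (F t - F 0)) +
    (h^-1 * (F t - F h) + (t^-1 - h^-1) * (F t - F 0)) by ring.
rewrite (le_trans (ler_normD _ _))// [leRHS](splitr e) lerD//.
by rewrite (le_trans (ler_normD _ _))// (le_trans (lerD D1 D2))//; lra.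
Qed.

(* Derivability read off countably many difference quotients, which makes the
   set of points of derivability measurable. *)
Lemma lipschitz_derivableP (V : normedModType R) (f : V -> R) (v x : V) (K : R) :
  (forall s t, `|f (x + s *: v) - f (x + t *: v)| <= K * `|s - t|) ->
  let r := limn_esup (fun k => (dquot f v x k.+1%:R^-1)%:E) in
  derivable f x v <->
  [/\ limn_einf (fun k => (dquot f v x k.+1%:R^-1)%:E) = r,
     limn_esup (fun k => (dquot f v x (- k.+1%:R^-1))%:E) = r &
     limn_einf (fun k => (dquot f v x (- k.+1%:R^-1))%:E) = r].
Proof.
move=> fK r; split=> [df|[er sl el]].
  have cr : (dquot f v x k.+1%:R^-1)%:E @[k --> \oo] --> ('D_v f x)%:E.
    by apply/fine_cvgP; split; [exact: nearW|exact: cvg_dquotr].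
  have cl : (dquot f v x (- k.+1%:R^-1))%:E @[k --> \oo] --> ('D_v f x)%:E.
    by apply/fine_cvgP; split; [exact: nearW|exact: cvg_dquotl].
  rewrite /r; have [-> ->] := cvg_limn_einf_sup cr.
  by have [-> ->] := cvg_limn_einf_sup cl.
have fK0 s : `|f (x + s *: v) - f x| <= K * `|s|.
  by have := fK s 0; rewrite scale0r addr0 subr0.
have rK : (- K%:E <= r <= K%:E)%E.
  by apply: limn_esup_bounded => k; apply: dquot_le.
have [L rE] : exists L, r = L%:E.
  by move: rK; case: (r) => [s _|/andP[]|/andP[]]//; exists s.
rewrite rE in er sl el.
have /fine_cvgP[_ cr] := limn_esup_einf_cvg er rE.
have /fine_cvgP[_ cl] := limn_esup_einf_cvg el sl.
apply/cvg_ex; exists L => /=.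
have dq := @dquot_cvg (fun s => f (x + s *: v)) K L fK.
rewrite /= scale0r addr0 in dq.
apply: (cvg_trans _ (dq _ _)).
- by apply: near_eq_cvg; apply: nearW => h /=; rewrite (addrC x).
- move: cr; apply: cvg_trans; apply: near_eq_cvg; apply: nearW => k /=.
  by rewrite /dquot invrK.
- move: cl; apply: cvg_trans; apply: near_eq_cvg; apply: nearW => k /=.
  by rewrite /dquot invrN invrK.
Qed.

Lemma measurable_limn_esup_fine d (T : measurableType d) (F : nat -> T -> R) :
  (forall k, measurable_fun setT (F k)) ->
  measurable_fun setT (fun x => fine (limn_esup (fun k => (F k x)%:E))).
Proof.
move=> mF; apply: measurableT_comp => //.
by apply: measurable_fun_limn_esup => k; apply/measurable_EFinP.
Qed.

End lipschitz_real.

(** * The dual logarithmic Sobolev inequality on the line *)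

Section gaussian_line.
Context {R : realType}.
Notation mu := (@lebesgue_measure R).
Notation phi := (@normal_pdf R 0 1).

(* [T] transports the distribution with cumulative function [H] to the one with
   cumulative function [G]. *)
Lemma monotone_transport (G H : R -> R) (a b m L : R) : a < b -> 0 < m ->
  continuous G ->
  (forall x y, a <= x -> x <= y -> y <= b -> m * (y - x) <= G y - G x) ->
  (forall x y, a <= x -> x <= y -> y <= b -> 0 <= H y - H x <= L * (y - x)) ->
  G a = H a -> G b = H b ->
  exists T : R -> R, [/\ forall x, a <= T x <= b,
    forall x, G (T x) = H (clamp a b x), T a = a, T b = b &
    forall x y, `|T x - T y| <= m^-1 * L * `|x - y| ].
Proof.
move=> ab m0 cG Gm HL Ga Gb.
have ex x : exists t, a <= t <= b /\ G t = H (clamp a b x).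
  have /andP[ax xb] := clamp_itv x (ltW ab).
  have [| | |t tab tE] := @IVT _ G a b (H (clamp a b x)).
  - exact: ltW.
  - exact: continuous_subspaceT.
  - have := Gm _ _ (lexx a) (ltW ab) (lexx b); have := HL _ _ (lexx a) ax xb.
    have := HL _ _ ax xb (lexx b); rewrite Ga Gb => /andP[? _] /andP[? _] _.
    by rewrite ge_min le_max; apply/andP; split; apply/orP; [left|right]; lra.
  - by exists t; split => //; move: tab; rewrite in_itv.
have [T TP] := choice ex.
(* [G] expands distances by at least [m]: this gives both the endpoint values of [T], by
   injectivity, and its Lipschitz constant. *)
have Ginj u v : a <= u <= b -> a <= v <= b -> m * `|u - v| <= `|G u - G v|.
  wlog uv : u v / u <= v => [wl|/andP[au ub] /andP[av vb]].
    by have [/wl//|/ltW/wl vu ? ?] := leP u v; rewrite distrC (distrC (G u)) vu.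
  rewrite distrC (distrC (G u)) (ger0_norm (_ : 0 <= v - u)) ?subr_ge0//.
  exact: le_trans (Gm _ _ au uv vb) (ler_norm _).
have HLn u v : a <= u <= b -> a <= v <= b -> `|H u - H v| <= L * `|u - v|.
  wlog uv : u v / u <= v => [wl|/andP[au ub] /andP[av vb]].
    by have [/wl//|/ltW/wl vu ? ?] := leP u v; rewrite distrC (distrC u) vu.
  rewrite distrC (distrC u) (ger0_norm (_ : 0 <= v - u)) ?subr_ge0//.
  by have /andP[H0 HLuv] := HL _ _ au uv vb; rewrite ger0_norm.
have L0 : 0 <= L.
  have /andP[h1 /(le_trans h1)] := HL _ _ (lexx a) (ltW ab) (lexx b).
  by rewrite pmulr_lge0// subr_gt0.
have aab : a <= a <= b by rewrite lexx ltW.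
have bab : a <= b <= b by rewrite lexx ltW.
have inj0 u v : a <= u <= b -> a <= v <= b -> G u = G v -> u = v.
  move=> uab vab Guv; apply/eqP; rewrite -subr_eq0 -normr_le0.
  by have := Ginj _ _ uab vab; rewrite Guv subrr normr0 pmulr_rle0.
exists T; split.
- by move=> x; have [] := TP x.
- by move=> x; have [] := TP x.
- by have [Tab TE] := TP a; apply: inj0 => //; rewrite TE clampE// Ga.
- by have [Tab TE] := TP b; apply: inj0 => //; rewrite TE clampE// Gb.
move=> x y; have [Tx GTx] := TP x; have [Ty GTy] := TP y.
rewrite -mulrA ler_pdivlMl//; apply: (le_trans (Ginj _ _ Tx Ty)).
rewrite GTx GTy (le_trans (HLn _ _ _ _)) ?clamp_itv ?(ltW ab)//.
by rewrite ler_wpM2l// clamp_lipschitz.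
Qed.

Lemma lipschitzM (f g : R -> R) (A B K M : R) :
  (forall x, `|f x| <= A) -> (forall x, `|g x| <= B) ->
  (forall x y, `|f x - f y| <= K * `|x - y|) ->
  (forall x y, `|g x - g y| <= M * `|x - y|) ->
  forall x y, `|f x * g x - f y * g y| <= (A * M + B * K) * `|x - y|.
Proof.
move=> fA gB fK gM x y.
have -> : f x * g x - f y * g y = f x * (g x - g y) + g y * (f x - f y) by ring.
rewrite (le_trans (ler_normD _ _))// mulrDl !normrM -!mulrA.
by rewrite lerD// ler_pM.
Qed.

Lemma phiE x : phi x = normal_peak 1 * expR (- (x ^+ 2 / 2)).
Proof.
by rewrite normal_pdfE ?oner_neq0// /normal_fun subr0 expr1n mulNr.
Qed.

Lemma peak_gt0 : 0 < normal_peak (1 : R).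
Proof. by rewrite normal_peak_gt0. Qed.

Lemma phi_gt0 x : 0 < phi x.
Proof. by rewrite phiE mulr_gt0 ?peak_gt0 ?expR_gt0. Qed.

Lemma phi_le (b x : R) : `|x| <= b -> phi b <= phi x <= normal_peak 1.
Proof.
move=> xb; rewrite normal_pdf_ub ?oner_neq0// andbT !phiE ler_wpM2l ?(ltW peak_gt0)//.
rewrite ler_expR lerN2 ler_wpM2r// -(ger0_norm (sqr_ge0 x)) normrX.
by rewrite lerXn2r ?nnegrE// (le_trans _ xb).
Qed.

Lemma is_derive_phi (x : R) : is_derive x 1 (phi : R -> R) (- x * phi x).
Proof.
have -> : (phi : R -> R) = (fun x => normal_peak 1 * expR (- (x ^+ 2 / 2))).
  by apply/funext => y; rewrite phiE.
apply: is_derive_eq; rewrite ?phiE /GRing.scale /=.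
by rewrite !mulr0; field.
Qed.

Lemma phi_clamp_lipschitz (b : R) : 0 <= b ->
  forall x y, `|phi (clamp (- b) b x) - phi (clamp (- b) b y)| <=
    normal_peak 1 * b * `|x - y|.
Proof.
move=> b0 x y; have bb : - b <= b by rewrite ge0_cp.
apply: (@le_trans _ _ (normal_peak 1 * b * `|clamp (- b) b x - clamp (- b) b y|)); last first.
  by rewrite ler_wpM2l ?clamp_lipschitz// mulr_ge0// ltW// peak_gt0.
have := clamp_itv x bb; have := clamp_itv y bb.
move: (clamp _ _ x) (clamp _ _ y) => {}x {}y.
wlog xy : x y / x ^+ 2 <= y ^+ 2 => [wl yb xb|yb xb].
  by have [/wl|/ltW/wl] := leP (x ^+ 2) (y ^+ 2); [|rewrite distrC (distrC x)]; exact.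
rewrite !phiE -mulrBr normrM (gtr0_norm peak_gt0) -[leRHS]mulrA.
rewrite ler_pM2l ?peak_gt0//.
set u := x ^+ 2 / 2; set v := y ^+ 2 / 2.
have u0 : 0 <= u by rewrite /u divr_ge0 ?sqr_ge0.
have uv : 0 <= v - u by rewrite subr_ge0 /u /v ler_pM2r.
have uvb : v - u <= b * `|x - y|.
  have -> : v - u = (x + y) / 2 * (y - x) by rewrite /u /v; field.
  rewrite (le_trans (ler_norm _))// normrM (distrC y) ler_wpM2r// ler_norml.
  by move/andP: xb => [? ?]; move/andP: yb => [? ?]; apply/andP; split; lra.
apply: le_trans uvb.
have -> : expR (- u) - expR (- v) = expR (- u) * (1 - expR (- (v - u))).
  by rewrite mulrBr mulr1 -expRD; congr (_ - expR _); ring.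
have e1 := expR_ge1Dx (- (v - u)).
have e2 : expR (- (v - u)) <= 1 by rewrite -expR0 ler_expR; lra.
rewrite ger0_norm ?mulr_ge0 ?expR_ge0 ?subr_ge0//.
rewrite (@le_trans _ _ (1 * (1 - expR (- (v - u)))))//; last by lra.
by rewrite ler_wpM2r ?subr_ge0// -expR0 ler_expR; lra.
Qed.

Lemma ae_le_Rintegral d (T : measurableType d) (nu : {measure set T -> \bar R})
    (D : set T) (f1 f2 : T -> R) : measurable D ->
  nu.-integrable D (EFin \o f1) -> nu.-integrable D (EFin \o f2) ->
  {ae nu, forall x, D x -> f1 x <= f2 x} ->
  \int[nu]_(x in D) f1 x <= \int[nu]_(x in D) f2 x.
Proof.
move=> mD i1 i2 f12; rewrite -subr_ge0 -RintegralB//.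
rewrite /Rintegral fine_ge0//.
have m1 := measurable_int _ i1; have m2 := measurable_int _ i2.
have mB : measurable_fun D (fun x => (f2 x - f1 x)%:E).
  apply/measurable_EFinP; apply: measurable_funB.
  - by apply/measurable_EFinP; exact: m2.
  - by apply/measurable_EFinP; exact: m1.
(* The difference is nonnegative only almost everywhere; its absolute value is so everywhere and has
   the same integral. *)
rewrite (@ae_eq_integral _ _ _ _ _ (fun x => `|(f2 x - f1 x)%:E|%E))//.
- by apply: integral_ge0 => x _; exact: abse_ge0.
- exact: measurableT_comp.
- apply: filterS f12.
  by move=> x + Dx => /(_ Dx); rewrite -subr_ge0 => f12; rewrite gee0_abs.
Qed.

(** Distribution function of the measure with density [E] relative to the Gaussian one. The source
    of the transport is a general [E], its target is [E = 1], and the same lemmas serve both. *)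
Definition gcdf (E : R -> R) (x : R) : R := \int[mu]_(t in `]-oo, x]) (E t * phi t).

Section gcdf.
Variables (E : R -> R) (M : R).
Hypotheses (mE : measurable_fun setT E) (E0 : forall x, 0 <= E x)
  (EM : forall x, E x <= M).

Lemma gcdf_integrable A : measurable A ->
  mu.-integrable A (EFin \o (fun t => E t * phi t)).
Proof.
move=> mA; apply: (integrableS measurableT) => //.
have iM : mu.-integrable setT (fun x => M%:E * (phi x)%:E)%E.
  by apply: integrableZl => //; exact: integrable_normal_pdf.
apply: le_integrable iM => //.
  apply/measurable_EFinP; apply: measurable_funM => //.
  exact: measurable_normal_pdf.
move=> x _ /=; rewrite lee_fin !normrM ler_wpM2r// !ger0_norm//.
exact: le_trans (E0 x) (EM x).
Qed.

Lemma gcdfB x y : x <= y ->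
  gcdf E y - gcdf E x = \int[mu]_(t in `]x, y]) (E t * phi t).
Proof.
move=> xy; rewrite /gcdf Rintegral_itvB//.
exact: gcdf_integrable.
Qed.

Lemma gcdf_derive : {ae mu, forall x, is_derive x (1 : R) (gcdf E) (E x * phi x)}.
Proof.
have loc : locally_integrable setT (fun t => E t * phi t).
  by apply: open_integrable_locally; [exact: openT|exact: gcdf_integrable].
have iy y : mu.-integrable `]-oo, y] (EFin \o (fun t => E t * phi t)).
  exact: gcdf_integrable.
have := FTC1Ny iy loc.
apply: filterS; first exact: (ae_filter_ringOfSetsType mu).
by move=> x /= [dF <-]; rewrite derive1E; apply: DeriveDef.
Qed.

Lemma gcdfB_le x y : x <= y ->
  0 <= gcdf E y - gcdf E x <= M * normal_peak 1 * (y - x).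
Proof.
move=> xy; rewrite gcdfB//; apply/andP; split.
  by apply: Rintegral_ge0 => t _; rewrite mulr_ge0// normal_pdf_ge0.
have -> : M * normal_peak 1 * (y - x) = \int[mu]_(t in `]x, y]) (M * normal_peak 1).
  rewrite Rintegral_cst// [X in fine X](_ : _ = (y - x)%:E)//.
  rewrite /= lebesgue_measure_itv/= lte_fin; case: ltP => //.
  by move=> yx; have -> : x = y by [apply/eqP; rewrite eq_le xy yx]; rewrite subrr.
apply: le_Rintegral => //; first exact: gcdf_integrable.
  apply: measurable_bounded_integrable => //.
    by rewrite /= lebesgue_measure_itv/=; case: ifP => _; rewrite -?EFinD ltry.
  exists `|M * normal_peak 1|; split; first exact: num_real.
  by move=> N MN t _ /=; exact: ltW.
move=> t _; rewrite ler_pM// ?normal_pdf_ge0//.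
by rewrite normal_pdf_ub ?oner_neq0.
Qed.

End gcdf.

Local Notation Phi := (gcdf (fun=> 1)).

(** Unlike [gcdf_derive], this holds at every point. It is applied at [T x], and nothing controls
    the preimage under [T] of an exceptional null set. *)
Lemma is_derive_Phi x : is_derive x (1 : R) Phi (phi x).
Proof.
have int1 A : measurable A -> mu.-integrable A (EFin \o (fun t => 1 * phi t)).
  by move=> mA; apply: (@gcdf_integrable _ 1).
have [||||dP P'] := @continuous_FTC1 R (fun t => 1 * phi t) -oo%O x (x + 1).
- by rewrite ltrDl.
- exact: int1.
- by rewrite ltNyr.
- by apply: cvgM; [exact: cvg_cst|exact: continuous_normal_pdf].
by rewrite -[phi x]mul1r -P' derive1E; exact: DeriveDef.
Qed.

Lemma continuous_Phi : continuous Phi.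
Proof.
by move=> x; apply: differentiable_continuous; apply/derivable1_diffP; case: (is_derive_Phi x).
Qed.

(** This is what the restriction to [[-b, b]] buys: a positive lower bound on the slope of the
    target distribution function, which makes the transport map Lipschitz. *)
Lemma Phi_lower b x y : - b <= x -> x <= y -> y <= b -> phi b * (y - x) <= Phi y - Phi x.
Proof.
move=> bx xy yb; rewrite (@gcdfB _ 1)//.
have -> : phi b * (y - x) = \int[mu]_(t in `]x, y]) phi b.
  rewrite Rintegral_cst// [X in fine X](_ : _ = (y - x)%:E)//.
  rewrite /= lebesgue_measure_itv/= lte_fin; case: ltP => //.
  by move=> yx; have -> : x = y by [apply/eqP; rewrite eq_le xy yx]; rewrite subrr.
apply: le_Rintegral => //.
- apply: measurable_bounded_integrable => //.
    by rewrite /= lebesgue_measure_itv/=; case: ifP => _; rewrite -?EFinD ltry.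
  exists `|phi b|; split; first exact: num_real.
  by move=> N MN t _ /=; exact: ltW.
- exact: (@gcdf_integrable _ 1).
move=> t /=; rewrite in_itv/= => /andP[xt ty]; rewrite mul1r.
have /andP[] // : phi b <= phi t <= normal_peak 1.
by apply: phi_le; rewrite ler_norml (le_trans bx (ltW xt)) (le_trans ty).
Qed.

Lemma measurable_dini (g : R -> R) : measurable_fun setT g ->
  measurable_fun setT (dini g (1 : R)).
Proof.
move=> mg; apply: measurable_limn_esup_fine => k.
apply: measurable_funM => //; apply: measurable_funB => //.
by apply: measurableT_comp => //; apply: measurable_funD.
Qed.

(* Writing [T] for the monotone map sending [e^(h-c) phi] to [phi] on [-b, b],
   the change of variables equation [T' phi(T) = e^(h-c) phi] and
   [ln T' <= T' - 1] bound [h - c] by an expression that is, after integration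
   by parts against [g^2 phi], at most [2 g'^2]. *)
Lemma transport_pointwise (x t p g d u : R) : 0 < p ->
  p * phi t = expR u * phi x ->
  u * g ^+ 2 * phi x <=
  (p - 1) * (phi x * g ^+ 2) +
    (t - x) * (- x * phi x * g ^+ 2 + phi x * (2 * g * d)) + 2 * d ^+ 2 * phi x.
Proof.
move=> p0; rewrite !phiE => pt.
have pk0 := peak_gt0.
have {}pt : p * expR (- (t ^+ 2 / 2)) = expR (u - x ^+ 2 / 2).
  have pkn0 : normal_peak 1 != 0 :> R by rewrite gt_eqF.
  by rewrite expRD; apply: (mulfI pkn0); rewrite mulrCA pt mulrCA.
have lnp : ln p - t ^+ 2 / 2 = u - x ^+ 2 / 2.
  by rewrite -[RHS]expRK -pt lnM ?posrE ?expR_gt0// expRK.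
have lp : ln p <= p - 1.
  by rewrite -[p in leLHS](subrK 1) addrC; apply: le_ln1Dx; lra.
have ph0 := phi_gt0 x; rewrite !phiE in ph0.
set F := normal_peak 1 * _ in ph0 *.
rewrite -subr_ge0.
(* The gap between the two sides consists of the slack in [ln p <= p - 1] and of a completed square;
   the square is what fixes the constant [2] in front of [d ^+ 2]. *)
have -> : (p - 1) * (F * g ^+ 2) + (t - x) * (- x * F * g ^+ 2 + F * (2 * g * d)) +
  2 * d ^+ 2 * F - u * g ^+ 2 * F = F * ((p - 1 - ln p) * g ^+ 2 + 
   ((t - x) * g + 2 * d) ^+ 2 / 2).
  have -> : u = ln p - t ^+ 2 / 2 + x ^+ 2 / 2 by lra.
  by field.
apply: mulr_ge0; first exact: ltW.
by rewrite addr_ge0// mulr_ge0 ?sqr_ge0 ?subr_ge0 ?invr_ge0.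
Qed.

(** * The dual inequality on a bounded interval *)

Section log_sobolev_itv.
Variables (g h : R -> R) (B K C b : R).
Hypotheses (gB : forall x, `|g x| <= B)
  (gK : forall x y, `|g x - g y| <= K * `|x - y|)
  (mh : measurable_fun setT h) (hC : forall x, `|h x| <= C) (b0 : 0 < b).

Let I := `]- b, b]%classic : set R.
Let Z := \int[mu]_(x in I) (expR (h x) * phi x).
Let c := ln (Z / (Phi b - Phi (- b))).
(** The value [1] off the interval makes the distribution functions of [E phi] and [phi] agree at
    [-b]; the normalization by [c] then makes them agree at [b], as [monotone_transport]
    requires. *)
Let E (x : R) := if (- b < x <= b) then expR (h x - c) else 1.

Let bb : - b < b. Proof. by rewrite gt0_cp. Qed.
Let Phi_gt0 : 0 < Phi b - Phi (- b).
Proof.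
apply: lt_le_trans (Phi_lower (lexx (- b)) (ltW bb) (lexx b)).
by rewrite mulr_gt0 ?phi_gt0// subr_gt0.
Qed.

Let mI : measurable I. Proof. exact: measurable_itv. Qed.

Let C0 : 0 <= C. Proof. exact: le_trans (hC 0). Qed.

Let hle x : - C <= h x <= C. Proof. by rewrite -ler_norml. Qed.

Let mexph : measurable_fun setT (fun x => expR (h x)).
Proof. exact: measurableT_comp. Qed.

Let eh_gt0 x : 0 <= expR (h x). Proof. exact: expR_ge0. Qed.
Let eh_le x : expR (h x) <= expR C.
Proof. by rewrite ler_expR; case/andP: (hle x). Qed.

Let ZB : expR (- C) * (Phi b - Phi (- b)) <= Z <= expR C * (Phi b - Phi (- b)).
Proof.
have i1 : mu.-integrable I (EFin \o (fun t => 1 * phi t)) by exact: (@gcdf_integrable _ 1).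
have i2 : mu.-integrable I (EFin \o (fun t => expR (h t) * phi t)).
  exact: (@gcdf_integrable _ (expR C)).
rewrite (@gcdfB _ 1 _ _ _ _ _ (ltW bb))// /Z -!RintegralZl//.
have iZ r : mu.-integrable I (EFin \o (fun t => r * (1 * phi t))).
  rewrite (_ : EFin \o _ = (fun t => r%:E * (1 * phi t)%:E)%E)//.
  exact: integrableZl.
apply/andP; split; apply: le_Rintegral => // x _.
  by rewrite mul1r ler_wpM2r ?normal_pdf_ge0// ler_expR; case/andP: (hle x).
by rewrite mul1r ler_wpM2r ?normal_pdf_ge0.
Qed.

Let Z_gt0 : 0 < Z.
Proof. by case/andP: ZB => + _; apply: lt_le_trans; rewrite mulr_gt0 ?expR_gt0. Qed.

Let cC : - C <= c <= C.
Proof.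
by case/andP: ZB => ZB1 ZB2; apply/andP; split; rewrite /c -ler_expR lnK ?posrE ?divr_gt0//
  ?ler_pdivlMr ?ler_pdivrMr.
Qed.

Let mE : measurable_fun setT E.
Proof.
apply: measurable_fun_ifT => //.
  apply: measurable_and; exact: measurable_fun_ltr || exact: measurable_fun_ler.
apply: measurableT_comp => //; exact: measurable_funB.
Qed.

Let E_gt0 x : 0 < E x. Proof. by rewrite /E; case: ifP => _; rewrite ?expR_gt0. Qed.
Let E_le x : E x <= expR (C + C).
Proof.
rewrite /E; case: ifP => _; last by rewrite -expR0 ler_expR addr_ge0.
by rewrite ler_expR; case/andP: (hle x); case/andP: cC; lra.
Qed.

Let PhiE_Nb : Phi (- b) = gcdf E (- b).
Proof.
apply: eq_Rintegral => x; rewrite inE/= in_itv/= /E => xb.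
by rewrite ltNge xb.
Qed.

Let PhiE_b : Phi b = gcdf E b.
Proof.
suff : gcdf E b - gcdf E (- b) = Phi b - Phi (- b) by rewrite -PhiE_Nb => /addIr.
rewrite (@gcdfB _ (expR (C + C)) _ _ _ _ _ (ltW bb))//; last by move=> x; exact: ltW.
transitivity (\int[mu]_(x in I) (expR (- c) * (expR (h x) * phi x))).
  apply: eq_Rintegral => x; rewrite inE/= in_itv/= /E => ->.
  by rewrite mulrA -expRD (addrC (- c)).
rewrite RintegralZl//; last exact: (@gcdf_integrable _ (expR C)).
rewrite -/Z /c expRN lnK ?posrE ?divr_gt0// invf_div mulfVK//.
by rewrite gt_eqF.
Qed.

Let J := `]- b, b[%classic : set R.

Let normM_le (x y r s : R) : `|x| <= r -> `|y| <= s -> `|x * y| <= r * s.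
Proof. by move=> xr ys; rewrite normrM ler_pM. Qed.

(** The subtracted logarithm normalizes [e^h] for the Gaussian conditioned to the interval. The
    function [(T - x) g^2 phi] vanishes at both ends, so its derivative has integral zero; once it
    is added on the right, the inequality holds pointwise almost everywhere, by
    [transport_pointwise]. *)
Lemma log_sobolev_itv :
  \int[mu]_(x in `]- b, b[)
    ((h x - ln (\int[mu]_(y in `]- b, b]) (expR (h y) * phi y) / (Phi b - Phi (- b)))) *
     g x ^+ 2 * phi x) <=
  \int[mu]_(x in `]- b, b[) (2 * dini g (1 : R) x ^+ 2 * phi x).
Proof.
rewrite -/I -/Z -/c -/J.
have [||T [Tb TE TNb Tbb TK]] := @monotone_transport Phi (gcdf E) (- b) b (phi b)
  (expR (C + C) * normal_peak 1) bb (phi_gt0 b) continuous_Phi _ _ PhiE_Nb PhiE_b.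
- by move=> x y; exact: Phi_lower.
- by move=> x y _ xy _; apply: gcdfB_le => // z; exact: ltW.
pose cl := clamp (- b) b.
have clb x : `|cl x| <= b by rewrite ler_norml clamp_itv// ltW.
have Tbn x : `|T x| <= b by rewrite ler_norml.
(* Clamping the arguments makes every factor bounded and Lipschitz on the whole line, and changes
   nothing on [[-b, b]]. *)
pose F x := (T x - cl x) * (phi (cl x) * (g (cl x) * g (cl x))).
have gclK x y : `|g (cl x) - g (cl y)| <= K * `|x - y|.
  have K0 : 0 <= K by have := gK 0 1; rewrite sub0r normrN normr1 mulr1; apply: le_trans.
  by rewrite (le_trans (gK _ _))// ler_wpM2l// clamp_lipschitz.
have ggK := lipschitzM (fun x => gB (cl x)) (fun x => gB (cl x)) gclK gclK.
have ggB x : `|g (cl x) * g (cl x)| <= B * B by rewrite normrM ler_pM.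
have phB x : `|phi (cl x)| <= normal_peak 1.
  by rewrite ger0_norm ?normal_pdf_ge0// normal_pdf_ub ?oner_neq0.
have phK := phi_clamp_lipschitz (ltW b0).
have pgK := lipschitzM phB ggB phK ggK.
have pgB x : `|phi (cl x) * (g (cl x) * g (cl x))| <= normal_peak 1 * (B * B).
  by rewrite normrM ler_pM.
have TclB x : `|T x - cl x| <= b + b by rewrite (le_trans (ler_normB _ _))// lerD.
have TclK x y : `|(T x - cl x) - (T y - cl y)| <=
    ((phi b)^-1 * (expR (C + C) * normal_peak 1) + 1) * `|x - y|.
  have -> : (T x - cl x) - (T y - cl y) = (T x - T y) + (cl y - cl x) by ring.
  rewrite mulrDl mul1r.
  by rewrite (le_trans (ler_normD _ _))// lerD// distrC clamp_lipschitz.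
have FK := lipschitzM TclB pgB TclK pgK.
have [d [dint dF d0]] := lipschitz_FTC bb FK.
have {}d0 : \int[mu]_(x in J) d x = 0.
  rewrite /J Rintegral_itv_obnd_cbnd; last exact: (integrableS measurableT).
  rewrite Rintegral_itv_bndo_bndc; last exact: (integrableS measurableT).
  rewrite /Rintegral d0 TNb Tbb /= /cl !clampE ?lexx ?ltW//.
  by rewrite !subrr !mul0r subrr.
have mJ : measurable J by exact: measurable_itv.
have mg : measurable_fun setT g.
  by apply: continuous_measurable_fun; exact: lipschitz_continuous gK.
have mD := measurable_dini mg.
have DK x : `|dini g (1 : R) x| <= K.
  apply: dini_le => s; rewrite (le_trans (gK _ _))//.
  by rewrite addrC addKr /GRing.scale/= mulr1.
have bint (f : R -> R) M : measurable_fun setT f -> (forall x, `|f x| <= M) ->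
    mu.-integrable J (EFin \o f).
  move=> mf fM; have iM : mu.-integrable `[- b, b] (EFin \o f).
    by apply: (@bounded_integrable_itv _ _ M) => //; exact: measurable_funTS.
  by apply: integrableS iM => //; apply: subset_itv; rewrite bnd_simp.
have i2 : mu.-integrable J (EFin \o (fun x => 2 * dini g (1 : R) x ^+ 2 * phi x)).
  apply: (@bint _ (2 * K ^+ 2 * normal_peak 1)).
    apply: measurable_funM; last exact: measurable_normal_pdf.
    by apply: measurable_funM => //; exact: measurable_funX.
  move=> x; apply: normM_le; last by rewrite ger0_norm ?normal_pdf_ge0// normal_pdf_ub ?oner_neq0.
  apply: normM_le; first by rewrite normr_nat.
  by rewrite normrX lerXn2r ?nnegrE// (le_trans _ (DK x)).
have i1 : mu.-integrable J (EFin \o (fun x => (h x - c) * g x ^+ 2 * phi x)).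
  apply: (@bint _ ((C + C) * B ^+ 2 * normal_peak 1)).
    apply: measurable_funM; last exact: measurable_normal_pdf.
    apply: measurable_funM; last exact: measurable_funX.
    exact: measurable_funB.
  move=> x; apply: normM_le; last by rewrite ger0_norm ?normal_pdf_ge0// normal_pdf_ub ?oner_neq0.
  apply: normM_le; last by rewrite normrX lerXn2r ?nnegrE// (le_trans _ (gB x)).
  by rewrite (le_trans (ler_normB _ _))// lerD// ler_norml.
have intd : mu.-integrable J (EFin \o d) by exact: (integrableS measurableT).
have -> : \int[mu]_(x in J) (2 * dini g (1 : R) x ^+ 2 * phi x) =
    \int[mu]_(x in J) (d x + 2 * dini g (1 : R) x ^+ 2 * phi x).
  by rewrite RintegralD// d0 add0r.
apply: ae_le_Rintegral => //.
  rewrite (_ : EFin \o _ = ((EFin \o d) \+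
    (EFin \o (fun x => (2 * dini g (1 : R) x ^+ 2 * phi x)%R)))%E)//.
  exact: integrableD.
have Tae := lipschitz_ae_derivable TK.
have gae := lipschitz_ae_derivable gK.
have Eae := gcdf_derive mE (fun x => ltW (E_gt0 x)) E_le.
have aeI : {ae mu, forall x, (derivable T x (1 : R) /\ derivable g x (1 : R)) /\
    (is_derive x (1 : R) (gcdf E) (E x * phi x) /\
     (- b < x < b -> is_derive x (1 : R) F (d x)))}.
  have FF := ae_filter_ringOfSetsType mu.
  exact: (@filterI _ _ FF _ _ (@filterI _ _ FF _ _ Tae gae) (@filterI _ _ FF _ _ Eae dF)).
move: aeI; apply: filterS; first exact: (ae_filter_ringOfSetsType mu).
move=> x /= [[/derivableP dT /derivableP dg] [dE dFx]].
rewrite /J /= in_itv /= => /andP[bx xb].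
have {}dFx : is_derive x (1 : R) F (d x) by apply: dFx; rewrite bx.
set p := 'D_(1 : R) T x in dT; set g' := 'D_(1 : R) g x in dg.
have clx : \near x, cl x = x.
  near=> y; rewrite /cl clampE//; apply/andP; split; apply/ltW; near: y;
  [exact: lt_nbhsr|exact: lt_nbhsl].
(* Differentiating [Phi (T x) = gcdf E x] in two ways gives the change of variables equation [pT],
   from which the positivity of [p = T'] follows too. *)
have dPT := is_derive1_comp (is_derive_Phi (T x)) dT.
have {}dPT : is_derive x (1 : R) (gcdf E) (phi (T x) * p).
  apply: near_eq_is_derive dPT; near=> y; rewrite /= TE; congr gcdf.
  by near: y.
have pT : p * phi (T x) = expR (h x - c) * phi x.
  rewrite mulrC -(@derive_val _ _ _ _ _ _ _ dPT) (@derive_val _ _ _ _ _ _ _ dE).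
  by rewrite /E bx ltW.
have p0 : 0 < p.
  by rewrite -(pmulr_lgt0 _ (phi_gt0 (T x))) pT mulr_gt0 ?expR_gt0 ?phi_gt0.
have := transport_pointwise (g x) g' p0 pT.
have d3 := is_deriveM (is_deriveB dT (is_derive_id x (1 : R)))
  (is_deriveM (is_derive_phi x) (is_deriveM dg dg)).
have clF : \near x, ((T - id) * ((phi : R -> R) * (g * g))) x = F x.
  near=> y; rewrite /F !fctE.
  by have -> : cl y = y by near: y.
have {}d3 := near_eq_is_derive clF d3.
have := @derive_val _ _ _ _ _ _ _ d3; rewrite (@derive_val _ _ _ _ _ _ _ dFx) => ->.
rewrite (dini_derive dg) !fctE /GRing.scale /= => /le_trans; apply.
rewrite le_eqVlt; apply/orP; left; apply/eqP; ring.
Unshelve. all: by end_near. Qed.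

End log_sobolev_itv.

Lemma cvg_integral_itv_phi (E : R -> R) (M : R) : measurable_fun setT E ->
  (forall x, 0 <= E x) -> (forall x, E x <= M) ->
  (\int[mu]_(x in `](- k%:R), k%:R[) (E x * phi x)) @[k --> \oo] -->
  \int[mu]_x (E x * phi x).
Proof.
move=> mE E0 EM; have iE A : measurable A -> mu.-integrable A (EFin \o (fun x => E x * phi x)).
  exact: (@gcdf_integrable E M).
pose J k := `](- k%:R), k%:R[%classic : set R.
have JT : \bigcup_k J k = setT.
  apply/seteqP; split => // x _; exists (Num.truncn `|x|).+1 => //=.
  by rewrite /J /= in_itv/= -ltr_norml truncnS_gt.
have : (\int[mu]_(x in J k) (E x * phi x)%:E)%E @[k --> \oo] -->
    (\int[mu]_(x in \bigcup_k J k) (E x * phi x)%:E)%E.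
  apply: ge0_nondecreasing_set_cvg_integral.
  - apply/nondecreasing_seqP => k; apply/subsetPset => x; rewrite /J /= !in_itv/= -!ltr_norml.
    by move=> /lt_trans; apply; rewrite ltr_nat.
  - by move=> k; exact: measurable_itv.
  - move=> k; apply: measurable_funTS; apply/measurable_EFinP.
    by apply: measurable_funM => //; exact: measurable_normal_pdf.
  - by move=> k x _; rewrite lee_fin mulr_ge0 ?normal_pdf_ge0.
rewrite JT -[X in _ --> X -> _]fineK; last exact: integrable_fin_num (iE _ measurableT).
by move=> /fine_cvgP[_].
Qed.

(** The interval is exhausted by [](-k), k[]. Adding [C g^2] to both integrands makes them
    nonnegative, so that monotone convergence applies and integrals over intervals are bounded by
    integrals over the line; [log_sobolev_line] removes it again. *)
Lemma gaussian_log_sobolev_line (g h : R -> R) (B K C : R) :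
  (forall x, `|g x| <= B) -> (forall x y, `|g x - g y| <= K * `|x - y|) ->
  measurable_fun setT h -> (forall x, `|h x| <= C) ->
  \int[mu]_x (expR (h x) * phi x) <= 1 ->
  \int[mu]_x (g x ^+ 2 * (h x + C) * phi x) <=
  \int[mu]_x (2 * dini g (1 : R) x ^+ 2 * phi x) + C * \int[mu]_x (g x ^+ 2 * phi x).
Proof.
move=> gB gK mh hC h1.
have mg : measurable_fun setT g.
  by apply: continuous_measurable_fun; exact: lipschitz_continuous gK.
have hle x : - C <= h x <= C by rewrite -ler_norml.
have DK x : `|dini g (1 : R) x| <= K.
  apply: dini_le => s; rewrite (le_trans (gK _ _))//.
  by rewrite addrC addKr /GRing.scale/= mulr1.
pose E1 x := g x ^+ 2 * (h x + C).
pose E2 x := 2 * dini g (1 : R) x ^+ 2.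
pose E3 x := g x ^+ 2.
have m3 : measurable_fun setT E3 by exact: measurable_funX.
have m1 : measurable_fun setT E1 by apply: measurable_funM => //; exact: measurable_funD.
have m2 : measurable_fun setT E2.
  by apply: measurable_funM => //; apply: measurable_funX; exact: measurable_dini.
have E30 x : 0 <= E3 x by exact: sqr_ge0.
have E3B x : E3 x <= B ^+ 2.
  by rewrite /E3 -real_normK ?num_real// lerXn2r ?nnegrE// (le_trans _ (gB x)).
have E20 x : 0 <= E2 x by rewrite mulr_ge0// sqr_ge0.
have E2B x : E2 x <= 2 * K ^+ 2.
  by rewrite ler_pM2l// -real_normK ?num_real// lerXn2r ?nnegrE// (le_trans _ (DK x)).
have hC0 x : 0 <= h x + C by rewrite -lerBlDr sub0r; case/andP: (hle x).
have E10 x : 0 <= E1 x by rewrite mulr_ge0 ?sqr_ge0.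
have E1B x : E1 x <= B ^+ 2 * (C + C).
  by apply: ler_pM; rewrite ?sqr_ge0 ?E3B// lerD2r; case/andP: (hle x).
have C0 : 0 <= C by exact: le_trans (hC 0).
set X := \int[mu]_x _; set Y := \int[mu]_x _; set A := \int[mu]_x (g x ^+ 2 * _).
have A0 : 0 <= A by apply: Rintegral_ge0 => x _; rewrite mulr_ge0 ?sqr_ge0 ?normal_pdf_ge0.
(* The slack [e] pays for the normalization on a bounded interval, which has mass below [1]: there
   [c] is only known to be at most [e], for large [k]. *)
suff main e : 0 < e -> X <= Y + (C + e) * A.
  apply/ler_addgt0Pr => e e0; have A1 : 0 < A + 1 by rewrite ltr_wpDl.
  apply: (le_trans (main (e / (A + 1)) _)); first by rewrite divr_gt0.
  rewrite mulrDl addrA lerD2l -mulrA ger_pMr// mulrC ler_pdivrMr//; lra.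
move=> e0.
have cvX := cvg_integral_itv_phi m1 E10 E1B.
have := @cvg_integral_itv_phi (fun=> 1) 1 (measurable_cst _) (fun=> ler01) (fun=> lexx 1).
rewrite [X in _ --> X -> _](_ : _ = 1); last first.
  by rewrite /Rintegral; under eq_integral do rewrite mul1r; rewrite integral_normal_pdf.
have e1 : expR (- e) < 1 by rewrite -expR0 ltr_expR oppr_lt0.
move=> /cvgr_gt/(_ _ e1) cv1.
rewrite -[X](cvg_lim (@Rhausdorff R) cvX); apply: limr_le; first exact: cvgP cvX.
near=> k.
have k0 : 0 < k%:R :> R by rewrite ltr0n; near: k; exact: nbhs_infty_gt.
have iE A' (E : R -> R) M : measurable A' -> measurable_fun setT E -> (forall x, 0 <= E x) ->
    (forall x, E x <= M) -> mu.-integrable A' (EFin \o (fun x => E x * phi x)).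
  by move=> mA mE E0 EM; exact: (@gcdf_integrable E M).
have kk : - k%:R < k%:R :> R by rewrite gt0_cp.
have mk : expR (- e) < Phi k%:R - Phi (- k%:R).
  rewrite (@gcdfB _ 1 _ _ _ _ _ (ltW kk))//.
  rewrite -Rintegral_itv_bndo_bndc; last exact: (@iE _ _ 1).
  by near: k.
have mk0 : 0 < Phi k%:R - Phi (- k%:R) by apply: lt_trans mk; exact: expR_gt0.
have := log_sobolev_itv gB gK mh hC k0.
set c := ln _ => LS.
have ie x : 0 <= expR (h x) by exact: expR_ge0.
have eC x : expR (h x) <= expR C by rewrite ler_expR; case/andP: (hle x).
have meh : measurable_fun setT (fun x => expR (h x)) by exact: measurableT_comp.
have le_setT (E : R -> R) M A' : measurable A' -> measurable_fun setT E -> (forall x, 0 <= E x) ->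
    (forall x, E x <= M) -> \int[mu]_(x in A') (E x * phi x) <= \int[mu]_x (E x * phi x).
  move=> mA mE E0 EM; rewrite /Rintegral fine_le//.
  - exact: integrable_fin_num (iE _ _ M mA mE E0 EM).
  - exact: integrable_fin_num (iE _ _ M measurableT mE E0 EM).
  apply: ge0_subset_integral => //.
    apply/measurable_EFinP; apply: measurable_funM => //; exact: measurable_normal_pdf.
  by move=> x _; rewrite lee_fin mulr_ge0 ?normal_pdf_ge0.
have ce : c <= e.
  rewrite -ler_expR; have [Z0|Z0] := ltP 0 (\int[mu]_(y in `]- k%:R, k%:R]) (expR (h y) * phi y)).
    rewrite lnK ?posrE ?divr_gt0// ler_pdivrMr//.
    rewrite (@le_trans _ _ 1)//; last by rewrite -ler_pdivrMl ?expR_gt0// mulr1 -expRN ltW.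
    by rewrite (le_trans _ h1)//; exact: (le_setT _ (expR C)).
  (* In this branch the argument of [ln] is nonpositive, where [ln] is [0] by convention. *)
  by rewrite ler_expR /c ln0 ?(ltW e0)// pmulr_lle0 ?invr_gt0.
have mJ : measurable (`](- k%:R), k%:R[%classic : set R) by exact: measurable_itv.
set J := `](- k%:R), k%:R[%classic in LS mJ *.
have -> : \int[mu]_(x in J) (g x ^+ 2 * (h x + C) * phi x) =
   \int[mu]_(x in J) ((h x - c) * g x ^+ 2 * phi x) + (C + c) * \int[mu]_(x in J) (E3 x * phi x).
  rewrite -RintegralZl ?(iE _ _ (B ^+ 2))// -RintegralD//.
  - by apply: eq_Rintegral => x _; rewrite /E3; ring.
  - have -> : EFin \o (fun x => (h x - c) * g x ^+ 2 * phi x) =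
      ((fun x : R => (E1 x * phi x)%R%:E) \-
       (fun x : R => (C + c)%:E * (E3 x * phi x)%R%:E))%E.
      apply/funext => x; transitivity (E1 x * phi x - (C + c) * (E3 x * phi x))%:E => //.
      by rewrite /E1 /E3 /=; congr EFin; ring.
    apply: integrableB => //; first exact: (iE _ _ (B ^+ 2 * (C + C))).
    by apply: integrableZl => //; exact: (iE _ _ (B ^+ 2)).
  - have -> : EFin \o (fun x => (C + c) * (E3 x * phi x)) =
       (fun x : R => (C + c)%:E * (E3 x * phi x)%R%:E)%E by [].
    by apply: integrableZl => //; exact: (iE _ _ (B ^+ 2)).
rewrite lerD//.
  by rewrite (le_trans LS)//; exact: (@le_setT E2 _ _ mJ m2 E20 E2B).
rewrite (@le_trans _ _ ((C + e) * \int[mu]_(x in J) (E3 x * phi x)))//.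
  rewrite ler_wpM2r ?lerD2l//.
  by apply: Rintegral_ge0 => x _; rewrite mulr_ge0 ?normal_pdf_ge0.
by rewrite ler_wpM2l ?addr_ge0 ?(ltW e0)//; exact: (@le_setT E3 _ _ mJ m3 E30 E3B).
Unshelve. all: by end_near. Qed.

End gaussian_line.

(** * Tensorization *)

Section bounded_measurable.
Context d (T : measurableType d) (R : realType).
Implicit Types F G : T -> R.

(** Such functions are integrable against every [weight] and stable under algebraic operations,
    slices and partial means, so that this one predicate discharges all side conditions of Fubini's
    theorem. *)
Definition bmeas F := measurable_fun setT F /\ exists M, forall x, `|F x| <= M.

Lemma bmeas_cst r : bmeas (fun=> r).
Proof. by split; [exact: measurable_cst|exists `|r|]. Qed.

Lemma bmeasD F G : bmeas F -> bmeas G -> bmeas (fun x => F x + G x).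
Proof.
move=> [mF [M FM]] [mG [N GN]]; split; first exact: measurable_funD.
by exists (M + N) => x; rewrite (le_trans (ler_normD _ _))// lerD.
Qed.

Lemma bmeasM F G : bmeas F -> bmeas G -> bmeas (fun x => F x * G x).
Proof.
move=> [mF [M FM]] [mG [N GN]]; split; first exact: measurable_funM.
by exists (M * N) => x; rewrite normrM ler_pM.
Qed.

Lemma bmeasB F G : bmeas F -> bmeas G -> bmeas (fun x => F x - G x).
Proof.
move=> [mF [M FM]] [mG [N GN]]; split; first exact: measurable_funB.
by exists (M + N) => x; rewrite (le_trans (ler_normB _ _))// lerD.
Qed.

Lemma bmeasX F k : bmeas F -> bmeas (fun x => F x ^+ k).
Proof.
move=> [mF [M FM]]; split; first exact: measurable_funX.
by exists (M ^+ k) => x; rewrite normrX lerXn2r ?nnegrE// (le_trans _ (FM x)).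
Qed.

Lemma bmeas_expR F : bmeas F -> bmeas (fun x => expR (F x)).
Proof.
move=> [mF [M FM]]; split; first exact: measurableT_comp.
exists (expR M) => x; rewrite ger0_norm ?expR_ge0// ler_expR.
exact: le_trans (ler_norm _) (FM x).
Qed.

Lemma bmeas_sum (I : Type) (r : seq I) (F : I -> T -> R) :
  (forall i, bmeas (F i)) -> bmeas (fun x => \sum_(i <- r) F i x).
Proof.
move=> bF; elim: r => [|i r IH].
  by under eq_fun do rewrite big_nil; exact: bmeas_cst.
by under eq_fun do rewrite big_cons; exact: bmeasD.
Qed.

End bounded_measurable.

Lemma bmeas_comp d (T : measurableType d) d' (U : measurableType d') (R : realType)
  (F : T -> R) (u : U -> T) : bmeas F -> measurable_fun setT u -> bmeas (F \o u).
Proof.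
by move=> [mF [M FM]] mu; split; [exact: measurableT_comp|exists M => x /=].
Qed.

Section weighted_mean.
Context d (T : measurableType d) (R : realType).
Variables (nu : {measure set T -> \bar R}) (w : T -> R).
Implicit Types F G : T -> R.

(** A probability density. Means are taken against densities because [lebesgue_row] is built as a
    product, whereas the Gaussian measure factors only through [gauss_pdf_cons]. *)
Definition weight :=
  [/\ measurable_fun setT w, forall x, 0 <= w x & (\int[nu]_x (w x)%:E = 1)%E].

Definition wmean F : R := \int[nu]_x (F x * w x).

Hypothesis ww : weight.

Lemma wmean_integrable F : bmeas F -> nu.-integrable setT (fun x => (F x * w x)%:E).
Proof.
case: ww => mw w0 w1 [mF [M FM]].
have iw : nu.-integrable setT (fun x => M%:E * (w x)%:E)%E.
  apply: integrableZl => //; apply/integrableP; split; first exact/measurable_EFinP.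
  by under eq_integral do rewrite gee0_abs ?lee_fin//; rewrite w1 ltry.
apply: le_integrable iw => //.
  by apply/measurable_EFinP; exact: measurable_funM.
move=> x _ /=; rewrite lee_fin !normrM ler_wpM2r//.
exact: le_trans (FM x) (ler_norm M).
Qed.

Lemma wmeanD F G : bmeas F -> bmeas G ->
  wmean (fun x => F x + G x) = wmean F + wmean G.
Proof.
move=> bF bG; rewrite /wmean -RintegralD//; try exact: wmean_integrable.
by apply: eq_Rintegral => x _; rewrite mulrDl.
Qed.

Lemma wmeanZ r F : bmeas F -> wmean (fun x => r * F x) = r * wmean F.
Proof.
move=> bF; rewrite /wmean -RintegralZl//; last exact: wmean_integrable.
by apply: eq_Rintegral => x _; rewrite mulrA.
Qed.

Lemma wmean_sum (I : Type) (r : seq I) (F : I -> T -> R) :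
  (forall i, bmeas (F i)) ->
  wmean (fun x => \sum_(i <- r) F i x) = \sum_(i <- r) wmean (F i).
Proof.
move=> bF; elim: r => [|i r IH].
  rewrite big_nil /wmean; under eq_Rintegral do rewrite big_nil mul0r.
  by rewrite Rintegral_cst// mul0r.
rewrite big_cons -IH -wmeanD//; last exact: bmeas_sum.
by apply: eq_Rintegral => x _; rewrite big_cons.
Qed.

Lemma le_wmean F G : bmeas F -> bmeas G -> (forall x, F x <= G x) ->
  wmean F <= wmean G.
Proof.
case: ww => mw w0 w1 bF bG FG; apply: le_Rintegral => //; try exact: wmean_integrable.
by move=> x _; rewrite ler_wpM2r.
Qed.

Lemma ae_le_wmean F G : bmeas F -> bmeas G -> {ae nu, forall x, F x <= G x} ->
  wmean F <= wmean G.
Proof.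
case: ww => mw w0 w1 bF bG FG; apply: ae_le_Rintegral => //; try exact: wmean_integrable.
by apply: filterS FG => x FG _; rewrite ler_wpM2r.
Qed.

Lemma wmean_cst r : wmean (fun=> r) = r.
Proof.
case: ww => mw w0 w1; rewrite /wmean.
rewrite (_ : (fun x => r * w x) = (fun x => r * (1 * w x))); last first.
  by apply/funext => x; rewrite mul1r.
rewrite RintegralZl//; last exact: (wmean_integrable (bmeas_cst _ 1)).
rewrite /Rintegral; under eq_integral do rewrite mul1r.
by rewrite w1/= mulr1.
Qed.

Lemma wmean_ge0 F : (forall x, 0 <= F x) -> 0 <= wmean F.
Proof.
by case: ww => mw w0 w1 F0; apply: Rintegral_ge0 => x _; rewrite mulr_ge0.
Qed.

Lemma wmean_bounded F M : bmeas F -> (forall x, `|F x| <= M) -> `|wmean F| <= M.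
Proof.
move=> bF FM; rewrite ler_norml; apply/andP; split.
  rewrite -(wmean_cst (- M)); apply: le_wmean => //; first exact: bmeas_cst.
  by move=> x; have := FM x; rewrite ler_norml => /andP[].
rewrite -(wmean_cst M); apply: le_wmean => //; first exact: bmeas_cst.
by move=> x; have := FM x; rewrite ler_norml => /andP[].
Qed.

End weighted_mean.

Section weighted_mean_prod.
Context d1 d2 (T1 : measurableType d1) (T2 : measurableType d2) (R : realType).
Variables (nu1 : {sigma_finite_measure set T1 -> \bar R})
  (nu2 : {sigma_finite_measure set T2 -> \bar R}) (w1 : T1 -> R) (w2 : T2 -> R).
Hypotheses (ww1 : weight nu1 w1) (ww2 : weight nu2 w2).

Let w12 (z : T1 * T2) := w1 z.1 * w2 z.2.

Lemma weight_prod : weight (nu1 \x nu2)%E w12.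
Proof.
case: ww1 => mw1 w10 w11; case: ww2 => mw2 w20 w21.
have mw : measurable_fun setT w12.
  apply: measurable_funM; apply: measurableT_comp => //.
split => //; first by move=> z; rewrite mulr_ge0.
rewrite (@fubini_tonelli1 _ _ _ _ _ nu1 nu2); last 2 first.
- exact/measurable_EFinP.
- by move=> z; rewrite lee_fin mulr_ge0.
rewrite -[RHS]w11; apply: eq_integral => x _; rewrite /fubini_F /w12 /=.
under eq_integral do rewrite EFinM.
rewrite ge0_integralZl ?w21 ?mule1//; first exact/measurable_EFinP.
- by move=> y _; rewrite lee_fin.
- by rewrite lee_fin.
Qed.

Lemma wmean_prod1 (F : T1 * T2 -> R) : bmeas F ->
  wmean (nu1 \x nu2)%E w12 F = wmean nu1 w1 (fun x => wmean nu2 w2 (fun y => F (x, y))).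
Proof.
move=> bF; rewrite /wmean /Rintegral -(@fubini1 _ _ _ _ _ nu1 nu2); last exact: (wmean_integrable weight_prod).
congr fine; apply: eq_integral => x _; rewrite /fubini_F /= /w12 /=.
have bFx : bmeas (fun y => F (x, y)).
  by apply: (bmeas_comp bF); exact: measurable_pair1.
under eq_integral do rewrite mulrCA EFinM.
rewrite integralZl//; last exact: wmean_integrable.
rewrite EFinM muleC fineK//.
by apply: integrable_fin_num => //; exact: wmean_integrable.
Qed.

Lemma wmean_prod2 (F : T1 * T2 -> R) : bmeas F ->
  wmean (nu1 \x nu2)%E w12 F = wmean nu2 w2 (fun y => wmean nu1 w1 (fun x => F (x, y))).
Proof.
move=> bF; rewrite /wmean /Rintegral -(@fubini2 _ _ _ _ _ nu1 nu2); last exact: (wmean_integrable weight_prod).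
congr fine; apply: eq_integral => y _; rewrite /fubini_G /= /w12 /=.
have bFy : bmeas (fun x => F (x, y)).
  by apply: (bmeas_comp bF); exact: measurable_pair2.
under eq_integral do rewrite mulrA EFinM.
rewrite integralZr//; last exact: wmean_integrable.
rewrite EFinM fineK//.
by apply: integrable_fin_num => //; exact: wmean_integrable.
Qed.

Lemma bmeas_wmean1 (F : T1 * T2 -> R) : bmeas F ->
  bmeas (fun x => wmean nu2 w2 (fun y => F (x, y))).
Proof.
move=> bF; have [mF [M FM]] := bF.
have bFx x : bmeas (fun y => F (x, y)).
  by apply: (bmeas_comp bF); exact: measurable_pair1.
split; last by exists M => x; apply: wmean_bounded.
case: (ww2) => mw2 w20 w21.
(* Shifting by the bound [M] makes the integrand nonnegative, so that Tonelli's theorem gives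
   measurability of the partial mean. *)
have M0 z : 0 <= F z + M by have := FM z; rewrite ler_norml; lra.
have E x : wmean nu2 w2 (fun y => F (x, y)) =
    fine (fubini_F nu2 (fun z => ((F z + M) * w2 z.2)%:E) x) - M.
  rewrite -[X in _ - X](wmean_cst ww2 M).
  apply/eqP; rewrite eq_sym subr_eq -wmeanD//; exact: bmeas_cst.
under eq_fun do rewrite E.
apply: measurable_funB => //; apply: measurableT_comp => //.
apply: measurable_fun_fubini_tonelli_F => [|z]; last by rewrite lee_fin mulr_ge0.
apply/measurable_EFinP; apply: measurable_funM; first exact: measurable_funD.
exact: measurableT_comp.
Qed.

Lemma bmeas_wmean2 (F : T1 * T2 -> R) : bmeas F ->
  bmeas (fun y => wmean nu1 w1 (fun x => F (x, y))).
Proof.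
move=> bF; have [mF [M FM]] := bF.
have bFy y : bmeas (fun x => F (x, y)).
  by apply: (bmeas_comp bF); exact: measurable_pair2.
split; last by exists M => y; apply: wmean_bounded.
case: (ww1) => mw1 w10 w11.
have M0 z : 0 <= F z + M by have := FM z; rewrite ler_norml; lra.
have E y : wmean nu1 w1 (fun x => F (x, y)) =
    fine (fubini_G nu1 (fun z => ((F z + M) * w1 z.1)%:E) y) - M.
  rewrite -[X in _ - X](wmean_cst ww1 M).
  apply/eqP; rewrite eq_sym subr_eq -wmeanD//; exact: bmeas_cst.
under eq_fun do rewrite E.
apply: measurable_funB => //; apply: measurableT_comp => //.
apply: measurable_fun_fubini_tonelli_G => [|z]; last by rewrite lee_fin mulr_ge0.
apply/measurable_EFinP; apply: measurable_funM; first exact: measurable_funD.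
exact: measurableT_comp.
Qed.

End weighted_mean_prod.

(** * Gaussian means on rows and induction on the dimension *)

Section gaussian_row.
Context {R : realType}.
Notation mu := (@lebesgue_measure R).
Notation phi := (@normal_pdf R 0 1).

Lemma weight_line : weight mu phi.
Proof.
split; [exact: measurable_normal_pdf|exact: normal_pdf_ge0|exact: integral_normal_pdf].
Qed.

Lemma weight_row n : weight (@lebesgue_row R n) (@gauss_pdf R n).
Proof.
split; [exact: measurable_gauss_pdf|exact: gauss_pdf_ge0|exact: gauss_setT].
Qed.

Definition gmean n (F : 'rV[R]_n -> R) : R := wmean (@lebesgue_row R n) (@gauss_pdf R n) F.

Lemma bmeas_cons n (F : 'rV[R]_n.+1 -> R) : bmeas F -> bmeas (F \o @cons_row R n).
Proof. by move=> bF; apply: bmeas_comp bF _; exact: measurable_cons_row. Qed.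

Lemma gmean_cons n (F : 'rV[R]_n.+1 -> R) : bmeas F ->
  gmean F = wmean (mu \x @lebesgue_row R n)%E
    (fun z : measurableTypeR R * 'rV[R]_n => phi z.1 * gauss_pdf z.2) (F \o @cons_row R n).
Proof.
move=> bF; rewrite /gmean /wmean /Rintegral; congr fine.
have mF : measurable_fun setT (fun x => (F x * gauss_pdf x)%:E).
  apply/measurable_EFinP; apply: measurable_funM; first by case: bF.
  exact: measurable_gauss_pdf.
rewrite [LHS](@integral_pushforward _ _ _ _ R _ (@measurable_cons_row R n)
  (lebesgue_measure \x @lebesgue_row R n)%E setT (fun x => (F x * gauss_pdf x)%:E))//=.
- rewrite preimage_setT; apply: eq_integral => -[x v] _ /=.
  by rewrite gauss_pdf_cons.
rewrite preimage_setT.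
have -> : (fun x => (F x * gauss_pdf x)%:E) \o @cons_row R n =
    (fun z => ((F \o @cons_row R n) z * (phi z.1 * gauss_pdf z.2))%:E).
  by apply/funext => -[x v] /=; rewrite gauss_pdf_cons.
apply: wmean_integrable; last exact: bmeas_cons.
exact: weight_prod weight_line (weight_row n).
Qed.

Lemma gmean_cons1 n (F : 'rV[R]_n.+1 -> R) : bmeas F ->
  gmean F = wmean mu phi (fun x => gmean (fun v => F (cons_row (x, v)))).
Proof.
move=> bF; rewrite gmean_cons//.
by rewrite (wmean_prod1 weight_line (weight_row n))//; exact: bmeas_cons.
Qed.

Lemma gmean_cons2 n (F : 'rV[R]_n.+1 -> R) : bmeas F ->
  gmean F = gmean (fun v => wmean mu phi (fun x => F (cons_row (x, v)))).
Proof.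
move=> bF; rewrite gmean_cons//.
by rewrite (wmean_prod2 weight_line (weight_row n))//; exact: bmeas_cons.
Qed.

Lemma bmeas_cons1 n (F : 'rV[R]_n.+1 -> R) (x : R) : bmeas F ->
  bmeas (fun v => F (cons_row (x, v))).
Proof.
move=> /bmeas_cons bF; apply: (bmeas_comp bF (u := fun v => (x, v))).
exact: measurable_pair1.
Qed.

Lemma bmeas_cons2 n (F : 'rV[R]_n.+1 -> R) (v : 'rV[R]_n) : bmeas F ->
  bmeas (fun x : measurableTypeR R => F (cons_row (x, v))).
Proof.
move=> /bmeas_cons bF; apply: (bmeas_comp bF (u := fun x => (x, v))).
exact: measurable_pair2.
Qed.

Lemma cons_rowDdelta n (x : R) (v : 'rV[R]_n) (t : R) (j : 'I_n) :
  cons_row (x, v) + t *: delta_mx 0 (lift ord0 j) = cons_row (x, v + t *: delta_mx 0 j).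
Proof.
apply/rowP => i; have [k ->|->] := unliftP ord0 i.
  by rewrite cons_rowS mxE cons_rowS !mxE/= (inj_eq lift_inj).
by rewrite cons_row0 mxE cons_row0 !mxE/= mulr0 addr0.
Qed.

Lemma cons_rowDdelta0 n (x : R) (v : 'rV[R]_n) (t : R) :
  cons_row (x, v) + t *: delta_mx 0 ord0 = cons_row (x + t, v).
Proof.
apply/rowP => i; have [k ->|->] := unliftP ord0 i.
  by rewrite cons_rowS mxE cons_rowS !mxE/= mulr0 addr0.
by rewrite cons_row0 mxE cons_row0 !mxE/= mulr1.
Qed.

Lemma subr_row n (v w : 'rV[R]_n) i : (v - w) 0 i = v 0 i - w 0 i.
Proof. by rewrite !mxE. Qed.

Lemma enorm_cons1 n (x : R) (v w : 'rV[R]_n) :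
  enorm (cons_row (x, v) - cons_row (x, w)) = enorm (v - w).
Proof.
rewrite /enorm big_ord_recl subr_row !cons_row0 subrr expr0n add0r; congr Num.sqrt.
by apply: eq_bigr => i _; rewrite !subr_row !cons_rowS.
Qed.

Lemma enorm_cons2 n (x y : R) (v : 'rV[R]_n) :
  enorm (cons_row (x, v) - cons_row (y, v)) = `|x - y|.
Proof.
rewrite /enorm big_ord_recl subr_row !cons_row0 big1 ?addr0 ?sqrtr_sqr// => i _.
by rewrite subr_row !cons_rowS subrr expr0n.
Qed.

Lemma enormZ n (t : R) (v : 'rV[R]_n) : enorm (t *: v) = `|t| * enorm v.
Proof.
rewrite /enorm; under eq_bigr do rewrite mxE exprMn.
by rewrite -mulr_sumr sqrtrM ?sqr_ge0// sqrtr_sqr.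
Qed.

Lemma enorm_delta n (i : 'I_n) : enorm (delta_mx 0 i : 'rV[R]_n) = 1.
Proof.
rewrite /enorm (bigD1 i)//= big1 ?addr0; first by rewrite mxE !eqxx expr1n sqrtr1.
by move=> j ji; rewrite mxE (negbTE ji) andbF expr0n.
Qed.

Lemma dini_cons n (g : 'rV[R]_n.+1 -> R) (x : R) (v : 'rV[R]_n) (j : 'I_n) :
  dini g (delta_mx 0 (lift ord0 j)) (cons_row (x, v)) =
  dini (fun v => g (cons_row (x, v))) (delta_mx 0 j) v.
Proof.
by rewrite /dini /dquot; under eq_fun do rewrite cons_rowDdelta.
Qed.

Lemma dini_cons0 n (g : 'rV[R]_n.+1 -> R) (x : R) (v : 'rV[R]_n) :
  dini g (delta_mx 0 ord0) (cons_row (x, v)) =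
  dini (fun x : R => g (cons_row (x, v))) (1 : R) x.
Proof.
rewrite /dini /dquot; under eq_fun do rewrite cons_rowDdelta0.
by congr (fine (limn_esup _)); apply/funext => k; rewrite /GRing.scale/= mulr1.
Qed.

Lemma measurable_shift_row n (t : R) (u : 'rV[R]_n) :
  measurable_fun setT (fun x : 'rV[R]_n => x + t *: u).
Proof.
apply/measurable_fun_rowP => i; under eq_fun do rewrite !mxE.
by apply: measurable_funD => //; exact: measurable_coord_row.
Qed.

Lemma measurable_dquot n (f : 'rV[R]_n -> R) (u : 'rV[R]_n) (t : R) :
  measurable_fun setT f -> measurable_fun setT (fun x => dquot f u x t).
Proof.
move=> mf; apply: measurable_funM => //; apply: measurable_funB => //.
by apply: measurableT_comp => //; exact: measurable_shift_row.
Qed.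

Definition elip n (K : R) (f : 'rV[R]_n -> R) := forall x y, `|f x - f y| <= K * enorm (x - y).

Lemma elip_delta n K (f : 'rV[R]_n -> R) (i : 'I_n) x s t : elip K f ->
  `|f (x + s *: delta_mx 0 i) - f (x + t *: delta_mx 0 i)| <= K * `|s - t|.
Proof.
move=> fK; rewrite (le_trans (fK _ _))//.
have -> : x + s *: delta_mx 0 i - (x + t *: delta_mx 0 i) = (s - t) *: delta_mx 0 i.
  by rewrite opprD addrACA subrr add0r scalerBl.
by rewrite enormZ enorm_delta mulr1.
Qed.

Lemma bmeas_dini n K (g : 'rV[R]_n -> R) (i : 'I_n) : bmeas g -> elip K g ->
  bmeas (dini g (delta_mx 0 i)).
Proof.
move=> [mg _] gK; split.
  by apply: measurable_limn_esup_fine => k; exact: measurable_dquot.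
exists K => x; apply: dini_le => s.
by have := elip_delta i x s 0 gK; rewrite scale0r addr0 subr0.
Qed.

Lemma log_sobolev_line (g h : R -> R) (K : R) : bmeas g ->
  (forall x y, `|g x - g y| <= K * `|x - y|) -> bmeas h ->
  wmean mu phi (fun x => expR (h x)) <= 1 ->
  wmean mu phi (fun x => g x ^+ 2 * h x) <=
  wmean mu phi (fun x => 2 * dini g (1 : R) x ^+ 2).
Proof.
move=> bg gK bh h1; have [_ [B gB]] := bg; have [mh [C hC]] := bh.
have := gaussian_log_sobolev_line gB gK mh hC h1.
rewrite -/(wmean mu phi (fun x => g x ^+ 2 * (h x + C))).
rewrite -/(wmean mu phi (fun x => 2 * dini g (1 : R) x ^+ 2)).
rewrite -/(wmean mu phi (fun x => g x ^+ 2)).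
have -> : (fun x => g x ^+ 2 * (h x + C)) = (fun x => g x ^+ 2 * h x + C * g x ^+ 2).
  by apply/funext => x; ring.
have bg2 : bmeas (fun x => g x ^+ 2) by exact: bmeasX.
rewrite (wmeanD weight_line) ?(wmeanZ weight_line C)//.
- by rewrite lerD2r.
- exact: bmeasM.
- by apply: bmeasM => //; exact: bmeas_cst.
Qed.

(* The dual form of the logarithmic Sobolev inequality tensorizes: with
   [h1 x = ln E_v exp h(x, v)], apply it in [v] to [h - h1] for each [x], and in
   [x] to [h1] for each [v]. *)
Theorem gaussian_log_sobolev n (g h : 'rV[R]_n -> R) (K : R) : bmeas g -> elip K g ->
  bmeas h -> gmean (fun x => expR (h x)) <= 1 ->
  gmean (fun x => g x ^+ 2 * h x) <=
  \sum_(i < n) gmean (fun x => 2 * dini g (delta_mx 0 i) x ^+ 2).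
Proof.
elim: n => [|n IH] in g h *; move=> bg gK bh h1.
  (* In dimension [0] the mean is the value at the only point, and the normalization of [h] reads
     [h 0 <= 0]. *)
  have row0 (F : 'rV[R]_0 -> R) : gmean F = F 0.
    rewrite -[RHS](wmean_cst (weight_row 0)); apply: eq_Rintegral => x _.
    by rewrite (thinmx0 x).
  rewrite big_ord0 row0; move: h1; rewrite row0 -expR0 ler_expR => h0.
  by rewrite mulr_ge0_le0// sqr_ge0.
have beh := bmeas_expR bh.
have [_ [C hC]] := bh.
pose m1 (x : R) := gmean (fun v => expR (h (cons_row (x, v)))).
have bm1 : bmeas (m1 : measurableTypeR R -> R).
  exact: (bmeas_wmean1 (weight_row n) (bmeas_cons beh)).
have hle x : - C <= h x <= C by rewrite -ler_norml.
have m1C x : expR (- C) <= m1 x <= expR C.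
  apply/andP; split.
    rewrite -(wmean_cst (weight_row n) (expR (- C))).
    apply: (le_wmean (weight_row n)); [exact: bmeas_cst|exact: (bmeas_cons1 x beh)|].
    by move=> v; rewrite ler_expR; case/andP: (hle (cons_row (x, v))).
  rewrite -(wmean_cst (weight_row n) (expR C)).
  apply: (le_wmean (weight_row n)); [exact: (bmeas_cons1 x beh)|exact: bmeas_cst|].
  by move=> v; rewrite ler_expR; case/andP: (hle (cons_row (x, v))).
have m10 x : 0 < m1 x by case/andP: (m1C x) => + _; apply: lt_le_trans; exact: expR_gt0.
pose h1' (x : measurableTypeR R) := ln (m1 x).
have bh1' : bmeas h1'.
  split; first by apply: measurableT_comp; [exact: measurable_ln|case: bm1].
  exists C => x; rewrite ler_norml /h1' -ler_expR lnK ?posrE// -[X in _ && X]ler_expR lnK ?posrE//.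
pose h2 (x : R) (v : 'rV[R]_n) := h (cons_row (x, v)) - h1' x.
have bh2 x : bmeas (h2 x).
  by apply: bmeasB; [exact: bmeas_cons1|exact: bmeas_cst].
have h21 x : gmean (fun v => expR (h2 x v)) <= 1.
  rewrite (_ : (fun v => _) = (fun v => (m1 x)^-1 * expR (h (cons_row (x, v))))).
    rewrite /gmean (wmeanZ (weight_row n) _ (bmeas_cons1 x beh)).
    by rewrite mulVf// gt_eqF.
  by apply/funext => v; rewrite /h2 /h1' expRD expRN lnK ?posrE// mulrC.
have h11 : wmean mu phi (fun x => expR (h1' x)) <= 1.
  apply: le_trans h1; rewrite (gmean_cons1 beh) le_eqVlt; apply/orP; left; apply/eqP.
  by apply: eq_Rintegral => x _; rewrite /h1' lnK ?posrE.
have bD i : bmeas (fun x => 2 * dini g (delta_mx 0 i) x ^+ 2).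
  by apply: bmeasM; [exact: bmeas_cst|apply: bmeasX; exact: bmeas_dini gK].
have bgx x := bmeas_cons1 x bg.
have gKx (x : R) : elip K (fun v => g (cons_row (x, v))).
  by move=> v w; rewrite (le_trans (gK _ _))// enorm_cons1.
have bgv v := bmeas_cons2 v bg.
have gKv (v : 'rV[R]_n) x y : `|g (cons_row (x, v)) - g (cons_row (y, v))| <= K * `|x - y|.
  by rewrite (le_trans (gK _ _))// enorm_cons2.
pose A (z : measurableTypeR R * 'rV[R]_n) := g (cons_row z) ^+ 2 * h2 z.1 z.2.
pose B (z : measurableTypeR R * 'rV[R]_n) := g (cons_row z) ^+ 2 * h1' z.1.
have bg2 : bmeas (fun z : measurableTypeR R * 'rV[R]_n => g (cons_row z) ^+ 2).
  by apply: bmeasX; exact: bmeas_cons.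
have bh1z : bmeas (fun z : measurableTypeR R * 'rV[R]_n => h1' z.1).
  by apply: (bmeas_comp bh1').
have bB : bmeas B by exact: bmeasM.
have bA : bmeas A.
  apply: bmeasM => //.
  have -> : (fun z : measurableTypeR R * 'rV[R]_n => h2 z.1 z.2) =
    (fun z => (h \o @cons_row R n) z - h1' z.1) by apply/funext => -[].
  by apply: bmeasB => //; exact: bmeas_cons.
rewrite gmean_cons; last by apply: bmeasM => //; exact: bmeasX.
have -> : (fun x => g x ^+ 2 * h x) \o @cons_row R n = (fun z => A z + B z).
  by apply/funext => -[x v]; rewrite /A /B /h2 /=; ring.
rewrite (wmeanD (weight_prod weight_line (weight_row n)))// big_ord_recl addrC.
(* The two parts are integrated in opposite orders: [B], in [x] first, yields the first partial
   derivative by the inequality on the line; [A], in [v] first, yields the others by induction. *)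
rewrite (wmean_prod1 weight_line (weight_row n) bA) (wmean_prod2 weight_line (weight_row n) bB).
apply: lerD.
  rewrite (gmean_cons2 (bD _)); apply: (le_wmean (weight_row n)).
  - exact: (bmeas_wmean2 weight_line bB).
  - exact: (bmeas_wmean2 weight_line (bmeas_cons (bD _))).
  move=> v; apply: (le_trans (log_sobolev_line (bgv v) (gKv v) bh1' h11)).
  rewrite le_eqVlt; apply/orP; left; apply/eqP.
  by apply: eq_Rintegral => x _; rewrite dini_cons0.
have GE x j : gmean (fun v => 2 * dini (fun v => g (cons_row (x, v))) (delta_mx 0 j) v ^+ 2) =
    gmean (fun v => 2 * dini g (delta_mx 0 (lift ord0 j)) (cons_row (x, v)) ^+ 2).
  by rewrite /gmean; congr wmean; apply/funext => v; rewrite dini_cons.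
have GEf j : (fun x : measurableTypeR R =>
      gmean (fun v => 2 * dini (fun v => g (cons_row (x, v))) (delta_mx 0 j) v ^+ 2)) =
    (fun x => gmean (fun v => 2 * dini g (delta_mx 0 (lift ord0 j)) (cons_row (x, v)) ^+ 2)).
  by apply/funext => x; exact: GE.
rewrite [leRHS](_ : _ = \sum_(j < n) wmean mu phi (fun x =>
    gmean (fun v => 2 * dini (fun v => g (cons_row (x, v))) (delta_mx 0 j) v ^+ 2))); last first.
  apply: eq_bigr => j _; rewrite (gmean_cons1 (bD _)).
  exact: (congr1 (wmean mu phi) (esym (GEf j))).
have bS j : bmeas (fun x : measurableTypeR R =>
    gmean (fun v => 2 * dini (fun v => g (cons_row (x, v))) (delta_mx 0 j) v ^+ 2)).
  under eq_fun do rewrite GE.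
  exact: (bmeas_wmean1 (weight_row n) (bmeas_cons (bD (lift ord0 j)))).
rewrite -(wmean_sum weight_line)//.
apply: (le_wmean weight_line).
- exact: (bmeas_wmean1 (weight_row n) bA).
- exact: bmeas_sum.
by move=> x; exact: (IH _ _ (bgx x) (gKx x) (bh2 x) (h21 x)).
Qed.

(** * Partial derivatives of Lipschitz functions and of their truncations *)

Lemma derive_min0 (V : normedModType R) (f : V -> R) (v x : V) :
  (forall y, f x <= f y) -> derivable f x v -> 'D_v f x = 0.
Proof.
move=> fx df; apply/eqP; rewrite eq_le; apply/andP; split.
  apply: (ler_cvg_to (cvg_dquotl df) (cvg_cst 0)); apply: nearW => k.
  by rewrite /dquot nmulr_rle0 ?invr_lt0 ?oppr_lt0 ?invr_gt0// subr_ge0.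
apply: (ler_cvg_to (cvg_cst 0) (cvg_dquotr df)); apply: nearW => k.
by rewrite /dquot mulr_ge0// subr_ge0.
Qed.

(** Replaces a chain rule for the truncation, which has corners: comparing increments at [x] is
    enough wherever both derivatives exist. *)
Lemma le_norm_derive (V : normedModType R) (f g : V -> R) (v x : V) :
  (forall y, `|g y - g x| <= `|f y - f x|) -> derivable f x v -> derivable g x v ->
  `|'D_v g x| <= `|'D_v f x|.
Proof.
move=> gf df dg.
apply: (ler_cvg_to (cvg_norm (cvg_dquotr dg)) (cvg_norm (cvg_dquotr df))).
by apply: nearW => k; rewrite /dquot !normrM ler_wpM2l.
Qed.

Lemma enorm_le n (v : 'rV[R]_n) (e : R) : (forall i, `|v 0 i| <= e) ->
  enorm v <= Num.sqrt n%:R * `|e|.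
Proof.
move=> ve; rewrite /enorm -sqrtr_sqr -sqrtrM// ler_wsqrtr//.
rewrite mulr_natl -[n in X in _ <= X]card_ord -sumr_const ler_sum// => i _.
rewrite -real_normK ?num_real// lerXn2r ?nnegrE//.
exact: le_trans (ve i).
Qed.

Lemma rational_row_approx n (v : 'rV[R]_n) (e : R) : 0 < e ->
  exists q : 'rV[rat]_n, enorm (v - map_mx ratr q) <= e.
Proof.
move=> e0; pose d := e / (Num.sqrt n%:R + 1).
have s0 : 0 < Num.sqrt n%:R + 1 :> R by rewrite ltr_wpDl// sqrtr_ge0.
have d0 : 0 < d by rewrite divr_gt0.
have ex i : exists q : rat, `|v 0 i - ratr q| <= d.
  have /rat_in_itvoo[q] : v 0 i < v 0 i + d by rewrite ltrDl.
  rewrite in_itv/= => /andP[vq qv]; exists q.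
  by rewrite distrC ger0_norm ?subr_ge0 ?(ltW vq)// lerBlDl ltW.
have [q qP] := choice ex.
exists (\row_i q i); rewrite (le_trans (enorm_le (e := d) _))//.
  by move=> i; rewrite !mxE.
rewrite gtr0_norm// mulrCA ger_pMr// ler_pdivrMr// mul1r lerDl//.
Qed.

(* McShane's formula: an [elip] function is an infimum of countably many cones. *)
Lemma elip_measurable n K (f : 'rV[R]_n -> R) : elip K f -> measurable_fun setT f.
Proof.
move=> fK; have {}fK : elip `|K| f.
  by move=> x y; rewrite (le_trans (fK x y))// ler_wpM2r ?ler_norm// sqrtr_ge0.
apply: (measurability _ (RGenInftyO.measurableE R)) => _ [_ [c ->] <-]; rewrite setTI.
have -> : f @^-1` `]-oo, c[ = \bigcup_(q : 'rV[rat]_n)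
    [set x | f (map_mx ratr q) + `|K| * enorm (x - map_mx ratr q) < c].
  apply/seteqP; split => x /=; rewrite in_itv/=.
    move=> fxc; pose e := (c - f x) / (`|K| + `|K| + 1) / 2.
    have K0 : 0 < `|K| + `|K| + 1 by rewrite ltr_wpDl ?addr_ge0.
    have e0 : 0 < e by rewrite !divr_gt0// subr_gt0.
    have [q qe] := rational_row_approx x e0; exists q => //=.
    have := fK x (map_mx ratr q); rewrite ler_norml => /andP[+ _].
    have Kq : `|K| * enorm (x - map_mx ratr q) <= `|K| * e by rewrite ler_wpM2l.
    have : (`|K| + `|K|) * e < c - f x.
      rewrite /e [ltLHS](_ : _ = (c - f x) * ((`|K| + `|K|) / (`|K| + `|K| + 1) / 2)).
        rewrite gtr_pMr ?subr_gt0// ltr_pdivrMr// ltr_pdivrMr//; have := normr_ge0 K; lra.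
      by field; rewrite gt_eqF.
    rewrite mulrDl; lra.
  move=> [q _ /=]; apply: le_lt_trans.
  have := fK x (map_mx ratr q); rewrite ler_norml => /andP[_]; lra.
apply: countable_bigcupT_measurable => // q.
have mE : measurable_fun setT (fun x : 'rV[R]_n => f (map_mx ratr q) + `|K| * enorm (x - map_mx ratr q)).
  apply: measurable_funD => //; apply: measurable_funM => //.
  apply: measurableT_comp; first exact: measurable_enorm.
  apply/measurable_fun_rowP => i; under eq_fun do rewrite subr_row.
  by apply: measurable_funB => //; exact: measurable_coord_row.
rewrite -[X in measurable X]setTI; exact: measurable_fun_ltr.
Qed.

Lemma bmeas_indic d (T : measurableType d) (A : set T) : measurable A ->
  bmeas (\1_A : T -> R).
Proof.
move=> mA; split; first exact: measurable_indic.
by exists 1 => x; rewrite indicE normr_nat lern1; case: (_ \in _).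
Qed.

Lemma gaussianE n (A : set 'rV[R]_n) : measurable A -> gaussian A = (gmean \1_A)%:E.
Proof.
move=> mA; rewrite /gmean /wmean /Rintegral fineK; last first.
  apply: integrable_fin_num => //.
  exact: (wmean_integrable (weight_row n) (bmeas_indic mA)).
rewrite /gaussian [LHS]integral_mkcond; apply: eq_integral => x _.
by rewrite /patch indicE; case: ifP => _; rewrite ?mul1r ?mul0r.
Qed.

(** The exceptional set is null for [gaussian], while [gmean] integrates over [lebesgue_row], so
    [ae_le_wmean] does not apply directly. Adding [(M + N) * \1_A], of mean zero, to [G] makes the
    inequality true everywhere. *)
Lemma le_gmean_null n (F G : 'rV[R]_n -> R) (A : set 'rV[R]_n) : bmeas F -> bmeas G ->
  measurable A -> gaussian A = 0%E -> (forall x, ~ A x -> F x <= G x) ->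
  gmean F <= gmean G.
Proof.
move=> bF bG mA; rewrite gaussianE// => -[A0] FG.
have [_ [M FM]] := bF; have [_ [N GN]] := bG.
have bA := bmeas_indic mA.
rewrite -[leRHS]addr0 -(mulr0 (M + N)) -A0 /gmean -(wmeanZ (weight_row n))//.
rewrite -(wmeanD (weight_row n))//; last by apply: bmeasM => //; exact: bmeas_cst.
apply: (le_wmean (weight_row n)) => //.
  by apply: bmeasD => //; apply: bmeasM => //; exact: bmeas_cst.
move=> x; rewrite indicE; have [xA|xA] := boolP (x \in A).
  rewrite mulr1; have := FM x; have := GN x; rewrite !ler_norml; lra.
by rewrite mulr0 addr0; apply: FG; move/negP: xA; rewrite in_setE.
Qed.

(** Fubini's theorem in the direction [i]: induction on [n] peels off coordinates until [i] is the
    first one, in which the mean is then taken first. *)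
Lemma gaussian_null_slices n (i : 'I_n) (B : set 'rV[R]_n) : measurable B ->
  (forall x, mu [set t | B (x + t *: delta_mx 0 i)] = 0%E) -> gaussian B = 0%E.
Proof.
elim: n => [|n IH] in i B *; first by case: i.
move=> mB B0; rewrite gaussianE//; congr EFin.
have bB := bmeas_indic mB.
have [j iE|iE] := unliftP ord0 i; rewrite iE in B0.
  rewrite (gmean_cons1 bB) -[RHS](wmean_cst weight_line 0); congr wmean; apply/funext => x.
  have mBx : measurable [set v | B (cons_row (x, v))].
    rewrite -[X in measurable X]setTI.
    have m1 : measurable_fun setT (fun v : 'rV[R]_n => cons_row (x, v)).
      exact: (measurableT_comp (@measurable_cons_row R n) (measurable_pair1 x)).
    exact: m1.
  have : gaussian [set v | B (cons_row (x, v))] = 0%E.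
    apply: (IH j _ mBx) => v; rewrite -[RHS](B0 (cons_row (x, v))); congr mu.
    by apply/seteqP; split => t /=; rewrite cons_rowDdelta.
  by rewrite gaussianE// => -[].
rewrite (gmean_cons2 bB) -[RHS](wmean_cst (weight_row n) 0); congr wmean; apply/funext => v.
have bBv := bmeas_cons2 v bB.
apply/eqP; rewrite eq_le; apply/andP; split; last first.
  by apply: (wmean_ge0 weight_line) => x; rewrite indicE.
rewrite -[leRHS](wmean_cst weight_line 0).
apply: (ae_le_wmean weight_line) => //; first exact: bmeas_cst.
exists [set x | B (cons_row (x, v))]; split.
- have m2 : measurable_fun setT (fun x : measurableTypeR R => cons_row (x, v)).
    exact: (measurableT_comp (@measurable_cons_row R n) (measurable_pair2 v)).
  by rewrite -[X in measurable X]setTI; exact: m2.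
- rewrite -[RHS](B0 (cons_row (0, v))); congr mu; apply/seteqP; split => t /=;
  by rewrite cons_rowDdelta0 add0r.
- by move=> x /=; apply: contra_notP => xB; rewrite indicE memNset.
Qed.

(** [gaussian_null_slices] asks for a measurable set; by [lipschitz_derivableP] derivability amounts
    to three equalities between upper and lower limits of countably many measurable quotients. *)
Lemma measurable_derivable n K (f : 'rV[R]_n -> R) (i : 'I_n) : elip K f ->
  measurable [set x | derivable f x (delta_mx 0 i)].
Proof.
move=> fK; have mf := elip_measurable fK.
pose r (x : 'rV[R]_n) := limn_esup (fun k => (dquot f (delta_mx 0 i) x k.+1%:R^-1)%:E).
pose r' (x : 'rV[R]_n) := limn_einf (fun k => (dquot f (delta_mx 0 i) x k.+1%:R^-1)%:E).
pose l (x : 'rV[R]_n) := limn_esup (fun k => (dquot f (delta_mx 0 i) x (- k.+1%:R^-1))%:E).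
pose l' (x : 'rV[R]_n) := limn_einf (fun k => (dquot f (delta_mx 0 i) x (- k.+1%:R^-1))%:E).
have mr : measurable_fun setT r.
  by apply: measurable_fun_limn_esup => k; apply/measurable_EFinP; exact: measurable_dquot.
have ml : measurable_fun setT l.
  by apply: measurable_fun_limn_esup => k; apply/measurable_EFinP; exact: measurable_dquot.
have mr' : measurable_fun setT r'.
  have -> : r' = (fun x => - limn_esup (fun k => - (dquot f (delta_mx 0 i) x k.+1%:R^-1)%:E))%E.
    by apply/funext => x; rewrite -[LHS]oppeK -limn_esupN.
  apply: measurableT_comp => //; apply: measurable_fun_limn_esup => k.
  by apply: measurableT_comp => //; apply/measurable_EFinP; exact: measurable_dquot.
have ml' : measurable_fun setT l'.
  have -> : l' = (fun x => - limn_esup (fun k => - (dquot f (delta_mx 0 i) x (- k.+1%:R^-1))%:E))%E.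
    by apply/funext => x; rewrite -[LHS]oppeK -limn_esupN.
  apply: measurableT_comp => //; apply: measurable_fun_limn_esup => k.
  by apply: measurableT_comp => //; apply/measurable_EFinP; exact: measurable_dquot.
have meq (u v : 'rV[R]_n -> \bar R) : measurable_fun setT u -> measurable_fun setT v ->
    measurable [set x | u x = v x].
  move=> mu' mv; rewrite -[X in measurable X]setTI; exact: emeasurable_fun_eq.
have -> : [set x | derivable f x (delta_mx 0 i)] =
    [set x | r' x = r x] `&` [set x | l x = r x] `&` [set x | l' x = r x].
  apply/seteqP; split => x /=.
    by move=> /(lipschitz_derivableP (fun s t => elip_delta i x s t fK))[].
  move=> [[h1 h2] h3].
  by apply/(lipschitz_derivableP (fun s t => elip_delta i x s t fK)).
by apply: measurableI; [apply: measurableI|]; exact: meq.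
Qed.

Lemma gaussian_derivable n K (f : 'rV[R]_n -> R) (i : 'I_n) : elip K f ->
  gaussian (~` [set x | derivable f x (delta_mx 0 i)]) = 0%E.
Proof.
move=> fK; have mD := measurable_derivable i fK.
apply: (gaussian_null_slices (i := i)); first exact: measurableC.
move=> x; apply: measure_negligible.
  have ml : measurable_fun setT (fun t : measurableTypeR R => x + t *: delta_mx 0 i).
    apply/measurable_fun_rowP => j; under eq_fun do rewrite !mxE.
    by apply: measurable_funD => //; apply: measurable_funM.
  rewrite -[X in measurable X]setTI.
  by apply: (ml _ (~` [set x | derivable f x (delta_mx 0 i)])) => //; exact: measurableC.
pose F (s : R) := f (x + s *: delta_mx 0 i).
have FK s t : `|F s - F t| <= K * `|s - t| by exact: elip_delta.
have := lipschitz_ae_derivable FK.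
apply: negligibleS => t /=; apply: contra_not => dF.
move: dF; rewrite /derivable; set q := (fun h => h^-1 *: _).
set q' := (fun h => h^-1 *: _); suff -> : q = q' by [].
apply/funext => h; rewrite /q /q' /F /=; congr (_ *: (f _ - _)).
have -> : (h *: (1 : R) + t : R) = h + t by congr (_ + _); exact: mulr1.
by rewrite scalerDl addrCA.
Qed.

Lemma ae_derivable n K (f : 'rV[R]_n -> R) (i : 'I_n) : elip K f ->
  {ae @gaussian R n, forall x, derivable f x (delta_mx 0 i)}.
Proof.
move=> fK; exists (~` [set x | derivable f x (delta_mx 0 i)]); split => //.
  by apply: measurableC; exact: measurable_derivable fK.
exact: gaussian_derivable fK.
Qed.

Lemma ae_le_gmean n (F G : 'rV[R]_n -> R) : bmeas F -> bmeas G ->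
  {ae @gaussian R n, forall x, F x <= G x} -> gmean F <= gmean G.
Proof.
move=> bF bG [N [mN N0 FGN]]; apply: (le_gmean_null bF bG mN N0) => x xN.
by apply: contrapT => FG; apply: xN; exact: FGN.
Qed.

(** The cap [N] provides the boundedness that [gaussian_log_sobolev] asks of [g], as [f] may be
    unbounded; the resulting estimate does not depend on [N]. *)
Definition truncated n (f : 'rV[R]_n -> R) (a N : R) (x : 'rV[R]_n) : R :=
  clamp 0 N (`|f x| - a).

Lemma truncated_le n (f : 'rV[R]_n -> R) a N x y :
  `|truncated f a N x - truncated f a N y| <= `|f x - f y|.
Proof.
rewrite (le_trans (clamp_lipschitz _ _ _ _))// opprB addrA subrK.
exact: ler_dist_dist.
Qed.

(* A Faber-Krahn type inequality: among functions supported on a set of small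
   measure, the first eigenvalue is at least of order [ln (1 / t)].  It is the
   logarithmic Sobolev inequality against the function equal to [ln (1 / t) / 2]
   on the support and to [ln (1 - sqrt t)] outside. *)
Lemma gmean_truncated_sqr_le n (f : 'rV[R]_n -> R) (K M a N t : R) :
  elip K f -> 0 <= N -> 0 < t < 1 ->
  {ae @gaussian R n, forall x, enorm (gradient f x) <= M} ->
  (gaussian [set x | (a < `|f x|)%R] <= t%:E)%E ->
  gmean (fun x => truncated f a N x ^+ 2) * ln (1 / t) <= 4 * M ^+ 2 * t.
Proof.
move=> fK N0 /andP[t0 t1] fM At.
have mf := elip_measurable fK.
pose A := [set x | (a < `|f x|)%R].
have mA : measurable A.
  rewrite -[X in measurable X]setTI; apply: measurable_fun_ltr => //.
  exact: measurableT_comp.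
have {}At : gmean \1_A <= t by move: At; rewrite gaussianE// lee_fin.
pose g := truncated f a N.
have g0 x : 0 <= g x <= N by exact: clamp_itv.
have gA x : ~ A x -> g x = 0.
  move=> /negP; rewrite -leNgt => fa; rewrite /g /truncated /clamp.
  by rewrite max_l// ge_min subr_le0 fa orbT.
have gK : elip K g by move=> x y; rewrite (le_trans (truncated_le _ _ _ _ _))// fK.
have bg : bmeas g.
  split; first exact: elip_measurable gK.
  by exists N => x; case/andP: (g0 x) => h1 h2; rewrite ger0_norm.
pose r := Num.sqrt t.
have r0 : 0 < r by rewrite sqrtr_gt0.
have r2 : r ^+ 2 = t by rewrite sqr_sqrtr// ltW.
have r1 : r < 1 by rewrite -(ltr_pXn2r (n := 2)) ?nnegrE ?(ltW r0)// r2 expr1n.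
have lnr : ln (1 / t) = - ln r *+ 2.
  by rewrite div1r lnV ?posrE// -r2 lnXn// mulNrn.
(* Thus [e^h] is [1 / sqrt t] on [A] and [1 - sqrt t] off [A]; as [A] has measure at most [t], its
   mean is at most [t / sqrt t + 1 - sqrt t = 1]. *)
pose h x := (- ln r - ln (1 - r)) * \1_A x + ln (1 - r).
have bA := bmeas_indic mA.
have bh : bmeas h.
  by apply: bmeasD; [apply: bmeasM => //; exact: bmeas_cst|exact: bmeas_cst].
have eh : gmean (fun x => expR (h x)) <= 1.
  have -> : (fun x => expR (h x)) = (fun x => (r^-1 - (1 - r)) * \1_A x + (1 - r)).
    apply/funext => x; rewrite /h indicE; case: (x \in A).
      by rewrite !mulr1 !subrK expRN lnK// posrE.
    by rewrite !mulr0 !add0r lnK// posrE subr_gt0.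
  have bA' : bmeas (fun x => (r^-1 - (1 - r)) * \1_A x) by apply: bmeasM => //; exact: bmeas_cst.
  rewrite /gmean (wmeanD (weight_row n))//; last exact: bmeas_cst.
  rewrite (wmeanZ (weight_row n))// (wmean_cst (weight_row n)) -/(gmean _).
  have rr : 0 <= r^-1 - (1 - r).
    by rewrite subr_ge0 (@le_trans _ _ 1)// ?invf_ge1// ?ltW//; lra.
  have A0 : 0 <= gmean \1_A by apply: (wmean_ge0 (weight_row n)) => x; rewrite indicE.
  rewrite (@le_trans _ _ (r^-1 * r ^+ 2 + (1 - r)))//; last first.
    by rewrite expr2 mulKf ?gt_eqF//; lra.
  rewrite lerD2r (le_trans (ler_wpM2l rr At))// -r2 ler_wpM2r ?sqr_ge0//; lra.
have := gaussian_log_sobolev bg gK bh eh.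
have -> : (fun x => g x ^+ 2 * h x) = (fun x => (- ln r) * g x ^+ 2).
  apply/funext => x; rewrite /h indicE; have [xA|xA] := boolP (x \in A).
    by rewrite mulr1 subrK mulrC.
  by rewrite gA ?expr0n/= ?mul0r ?mulr0//; move/negP: xA; rewrite in_setE.
have bg2 : bmeas (fun x => g x ^+ 2) by exact: bmeasX.
have bD i : bmeas (fun x => 2 * dini g (delta_mx 0 i) x ^+ 2).
  by apply: bmeasM; [exact: bmeas_cst|apply: bmeasX; exact: bmeas_dini gK].
rewrite {1}/gmean (wmeanZ (weight_row n))// -(wmean_sum (weight_row n))// -!/(gmean _).
move=> LS.
have : gmean (fun x => \sum_(i < n) 2 * dini g (delta_mx 0 i) x ^+ 2) <=
    gmean (fun x => 2 * M ^+ 2 * \1_A x).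
  have fg : {ae @gaussian R n, forall x, forall i : 'I_n,
      derivable f x (delta_mx 0 i) /\ derivable g x (delta_mx 0 i)}.
    apply: filter_forall => i.
    by apply: filterI; [exact: ae_derivable fK|exact: ae_derivable gK].
  apply: ae_le_gmean.
  - exact: bmeas_sum.
  - by apply: bmeasM => //; exact: bmeas_cst.
  apply: filterS2 fM fg => x xM dfg.
  have df i : derivable f x (delta_mx 0 i) by case: (dfg i).
  have dg i : derivable g x (delta_mx 0 i) by case: (dfg i).
  rewrite -mulr_sumr -mulrA ler_pM2l//.
  have dE i : dini g (delta_mx 0 i) x = 'D_(delta_mx 0 i) g x by exact/dini_derive/derivableP.
  rewrite indicE; have [xA|xA] := boolP (x \in A).
    rewrite mulr1 (@le_trans _ _ (enorm (gradient f x) ^+ 2))//; last first.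
      by rewrite lerXn2r ?nnegrE ?sqrtr_ge0// (le_trans _ xM) ?sqrtr_ge0.
    rewrite /enorm sqr_sqrtr; last by apply: sumr_ge0 => i _; exact: sqr_ge0.
    apply: ler_sum => i _; rewrite dE mxE -[leLHS]real_normK ?num_real// -[leRHS]real_normK ?num_real//.
    rewrite lerXn2r ?nnegrE//; apply: le_norm_derive => // y; exact: truncated_le.
  (* Off [A] the truncation takes its minimum [0], so its partial derivatives vanish wherever they
     exist. This confines the right-hand side to [A], whose measure gives the factor [t]. *)
  rewrite mulr0 big1// => i _; rewrite dE derive_min0 ?expr0n// => y.
  by rewrite gA; [case/andP: (g0 y)|move/negP: xA; rewrite in_setE].
rewrite [leRHS](wmeanZ (weight_row n))// -/(gmean _) => le2.
have := ler_wpM2l (_ : 0 <= 2 * M ^+ 2) At; rewrite mulr_ge0 ?sqr_ge0// => /(_ isT).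
have := le_trans LS le2.
rewrite lnr -/g -/(gmean (fun x => g x ^+ 2)); move: (gmean _) (gmean _) => u v.
rewrite mulr2n; lra.
Qed.

End gaussian_row.

(** * Rearrangements *)

Section rearrangement.
Context {R : realType} (n : nat).
Notation gamma := (@gaussian R n).
Implicit Types f : 'rV[R]_n -> R.

Lemma measurable_superlevel f (a : R) : measurable_fun setT f ->
  measurable [set x | a < `|f x|].
Proof.
move=> mf; rewrite -[X in measurable X]setTI; apply: measurable_fun_ltr => //.
exact: measurableT_comp.
Qed.

Lemma le_gaussian_superlevel f (a b : R) : measurable_fun setT f -> a <= b ->
  (gamma [set x | (b < `|f x|)%R] <= gamma [set x | (a < `|f x|)%R])%E.
Proof.
move=> mf ab; apply: le_measure; rewrite ?inE; try exact: measurable_superlevel.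
by move=> x /=; exact: le_lt_trans.
Qed.

Lemma rearr_ge0 f s : 0 <= rearr f s.
Proof.
rewrite /rearr; set S := [set t | _]; have [S0|/set0P S0] := eqVneq S set0.
  (* An empty set of levels has infimum [0] by convention. *)
  by rewrite S0 inf0.
by apply: lb_le_inf => // t [].
Qed.

Lemma rearr_le f s a : 0 <= a -> (gamma [set x | (a < `|f x|)%R] <= s%:E)%E -> rearr f s <= a.
Proof.
move=> a0 fa; apply: ge_inf; last by split.
by exists 0 => t [].
Qed.

Lemma gaussian_superlevel_cvg0 f : measurable_fun setT f ->
  gamma [set x | k%:R < `|f x|] @[k --> \oo] --> 0%E.
Proof.
move=> mf; rewrite -(measure0 gamma).
have -> : set0 = \bigcap_k [set x | k%:R < `|f x|].
  apply/seteqP; split => // x /(_ (Num.truncn `|f x|).+1 I) /=.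
  by rewrite ltNge ltW// truncnS_gt.
apply: nonincreasing_cvg_mu.
- by rewrite (le_lt_trans (probability_le1 _ _))// ?ltry//; exact: measurable_superlevel.
- by move=> k; exact: measurable_superlevel.
- by apply: bigcapT_measurable => k; exact: measurable_superlevel.
- by move=> k l kl; apply/subsetPset => x /=; apply: le_lt_trans; rewrite ler_nat.
Qed.

(** A converse to [rearr_le] for strict inequalities. Positivity of [s] makes the set of levels
    nonempty, because the measures of the superlevel sets tend to zero. *)
Lemma rearr_lt f s a : measurable_fun setT f -> 0 < s -> rearr f s < a ->
  (gamma [set x | (a < `|f x|)%R] <= s%:E)%E.
Proof.
move=> mf s0; rewrite /rearr; set S := [set t | _] => Sa.
have S0 : S !=set0.
  have := gaussian_superlevel_cvg0 mf.
  have s0' : nbhs (0 : \bar R)%E [set y | (y < s%:E)%E].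
    by apply: open_nbhs_nbhs; split; [exact: open_ereal_lt_ereal|rewrite /= lte_fin].
  move=> /(_ _ s0')[k _ /(_ k (leqnn k)) /= ks].
  by exists k%:R; split => //; exact: ltW.
have hS : has_inf S by split => //; exists 0 => t [].
have e0 : 0 < a - inf S by rewrite subr_gt0.
have [t [t0 ts] ta] := inf_adherent e0 hS.
apply: le_trans ts; apply: le_gaussian_superlevel => //.
by move: ta; rewrite subrKC => /ltW.
Qed.

Lemma nonincreasing_rearr f s t : measurable_fun setT f -> 0 < s -> s <= t ->
  rearr f t <= rearr f s.
Proof.
move=> mf s0 st; apply/ler_addgt0Pr => e e0; apply: rearr_le.
  by rewrite addr_ge0 ?rearr_ge0// ltW.
by rewrite (@le_trans _ _ s%:E)%E ?lee_fin//; apply: rearr_lt => //; rewrite ltrDl.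
Qed.

Lemma measurable_rearr f t : measurable_fun setT f ->
  measurable_fun (`]0%R, t[%classic : set R) (rearr f).
Proof.
move=> mf mD; apply: (measurability _ (RGenInftyO.measurableE R)) => // _ [_ [c ->] <-].
apply: is_interval_measurable => x y [/=]; rewrite !in_itv/= => /andP[x0 xt] xc [/= /andP[y0 yt] yc].
move=> z /andP[xz zy]; rewrite /= !in_itv/= (lt_le_trans x0)//= (le_lt_trans zy)//; split => //.
exact: le_lt_trans (nonincreasing_rearr mf x0 xz) xc.
Qed.

Lemma rearr_elip_le f (K M s t : R) : elip K f -> 0 <= M ->
  {ae gamma, forall x, enorm (gradient f x) <= M} -> 0 < s -> 0 < t < 1 ->
  rearr f s <= rearr f t + 2 * M * Num.sqrt (t / ln (1 / t)) * (Num.sqrt s)^-1.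
Proof.
move=> fK M0 fM s0 t01; have /andP[t0 t1] := t01; have mf := elip_measurable fK.
set c := 2 * M * _ * _.
have l0 : 0 < ln (1 / t) by rewrite div1r ln_gt0// invf_gt1.
have c0 : 0 <= c by rewrite !mulr_ge0 ?invr_ge0 ?sqrtr_ge0.
(* [c] is the level at which Chebyshev's inequality yields exactly [s]: [c^2 s] is the bound
   [4 M^2 t / ln (1/t)] on [E g^2]. *)
have c2 : c ^+ 2 * s * ln (1 / t) = 4 * M ^+ 2 * t.
  rewrite /c !exprMn exprVn !sqr_sqrtr ?divr_ge0 ?(ltW t0) ?(ltW l0) ?(ltW s0)//.
  by field; rewrite !gt_eqF.
apply/ler_addgt0Pr => e e0; have e20 : 0 < e / 2 by rewrite divr_gt0.
(* Half of [e] lifts [a] strictly above [f^*(t)], as [rearr_lt] requires; the other half makes [tau]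
   positive even if [c = 0]. *)
pose a := rearr f t + e / 2; pose tau := c + e / 2.
have tau0 : 0 < tau by rewrite ltr_wpDl.
have a0 : 0 <= a by rewrite addr_ge0 ?rearr_ge0// ltW.
have -> : rearr f t + c + e = a + tau by rewrite /a /tau; field.
have At : (gamma [set x | (a < `|f x|)%R] <= t%:E)%E by apply: rearr_lt => //; rewrite ltrDl.
have tauN : 0 <= tau + 1 by rewrite addr_ge0 ?ltW.
have FK := gmean_truncated_sqr_le fK tauN t01 fM At.
apply: rearr_le; first by rewrite addr_ge0 ?(ltW tau0).
have mA := measurable_superlevel (a + tau) mf.
rewrite gaussianE// lee_fin.
set g := truncated f a (tau + 1) in FK.
have bA := bmeas_indic mA.
have gK : elip K g by move=> x y; rewrite (le_trans (truncated_le _ _ _ _ _))// fK.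
have g0 x : 0 <= g x <= tau + 1 by exact: clamp_itv.
have bg2 : bmeas (fun x => g x ^+ 2).
  apply: bmeasX; split; first exact: elip_measurable gK.
  by exists (tau + 1) => x; case/andP: (g0 x) => h1 h2; rewrite ger0_norm.
(* Chebyshev's inequality: the cap [tau + 1] lies above [tau], so [g] is at least [tau] wherever
   [|f| > a + tau]. *)
have Ag : gmean (fun x => tau ^+ 2 * \1_[set x | a + tau < `|f x|] x) <= gmean (fun x => g x ^+ 2).
  apply: (le_wmean (weight_row n)) => //; first by apply: bmeasM => //; exact: bmeas_cst.
  move=> x; rewrite indicE; have [|_] := boolP (_ \in _); last by rewrite mulr0 sqr_ge0.
  rewrite inE /= => fx; rewrite mulr1 lerXn2r ?nnegrE ?(ltW tau0)//.
    by case/andP: (g0 x).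
  rewrite /g /truncated /clamp le_max; apply/orP; right; rewrite le_min lerDl ler01/=.
  by rewrite lerBrDl ltW.
rewrite /gmean (wmeanZ (weight_row n))// -/(gmean _) -/(gmean _) in Ag.
have /= := le_trans (ler_wpM2r (ltW l0) Ag) FK.
rewrite -c2 => h.
have h' : tau ^+ 2 * ln (1 / t) * gmean \1_[set x | a + tau < `|f x|] <= tau ^+ 2 * ln (1 / t) * s.
  rewrite [leLHS]mulrAC [leRHS]mulrAC; apply: (le_trans h).
  rewrite ler_wpM2r ?(ltW l0)// ler_wpM2r ?(ltW s0)//.
  by rewrite lerXn2r ?nnegrE ?(ltW tau0)// lerDl ltW.
by move: h'; rewrite ler_pM2l// mulr_gt0// exprn_gt0.
Qed.

Lemma measurable_inv_sqrt (A : set R) : measurable A -> A `<=` `]0, +oo[%classic ->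
  measurable_fun A (fun s : R => (Num.sqrt s)^-1).
Proof.
move=> mA A0; have mO : measurable (`]0, +oo[%classic : set R) by exact: measurable_itv.
apply: (measurable_funS mO A0); apply: open_continuous_measurable_fun; first exact: interval_open.
move=> x; rewrite inE/= in_itv/= andbT => x0.
by apply: cvgV; [rewrite gt_eqF// sqrtr_gt0|exact: sqrt_continuous].
Qed.

Lemma integral_inv_sqrt_le (t : R) : 0 < t ->
  (\int[lebesgue_measure]_(s in `]0%R, t[) ((Num.sqrt s)^-1)%:E <= (2 * Num.sqrt t)%:E)%E.
Proof.
(* The improper integral is exhausted by [[a k, t[]; the shift in [k.+2] keeps [a k] strictly below
   [t] already for [k = 0]. *)
move=> t0; pose a k : R := t / k.+2%:R.
have a0 k : 0 < a k by rewrite divr_gt0.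
have at_ k : a k < t by rewrite /a ltr_pdivrMr// ltr_pMr// ltr1n.
pose F k := `[a k, t[%classic : set R.
have FT : \bigcup_k F k = `]0, t[%classic.
  apply/seteqP; split => x.
    by move=> [k _]; rewrite /F /= !in_itv/= => /andP[ax ->]; rewrite (lt_le_trans (a0 k)).
  rewrite /= in_itv/= => /andP[x0 xt]; exists (Num.truncn (t / x)) => //=.
  rewrite /F /= in_itv/= xt andbT /a ler_pdivrMr// mulrC -ler_pdivrMr// ltW//.
  by rewrite (lt_trans (truncnS_gt _))// ltr_nat.
have dsqrt (x : R) : 0 < x -> is_derive x (1 : R) (fun s : R => 2 * Num.sqrt s) (Num.sqrt x)^-1.
  move=> x0; have ds := is_derive1_sqrt x0.
  have := is_deriveZ (2 : R) ds.
  rewrite (_ : 2 *: _ = (Num.sqrt x)^-1); first exact.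
  by rewrite /GRing.scale/= invfM mulrA mulfV// mul1r.
have csqrt : continuous (fun s : R => 2 * Num.sqrt s).
  by move=> x; apply: cvgMr; exact: sqrt_continuous.
have int_le k : (\int[lebesgue_measure]_(s in F k) ((Num.sqrt s)^-1)%:E <= (2 * Num.sqrt t)%:E)%E.
  apply: (@le_trans _ _ (\int[lebesgue_measure]_(s in `[a k, t]) ((Num.sqrt s)^-1)%:E)%E).
    apply: ge0_subset_integral => //.
    - exact: measurable_itv.
    - apply/measurable_EFinP; apply: measurable_inv_sqrt => // x /=.
      by rewrite !in_itv/= andbT => /andP[+ _]; apply: lt_le_trans.
    - by apply: subset_itv; rewrite bnd_simp.
  rewrite (@continuous_FTC2 _ _ (fun s => 2 * Num.sqrt s)) //.
  - by rewrite -EFinB lee_fin gerBl mulr_ge0 ?sqrtr_ge0.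
  - apply: continuous_in_subspaceT => x; rewrite inE/= in_itv/= => /andP[ax _].
    apply: cvgV; last exact: sqrt_continuous.
    by rewrite gt_eqF// sqrtr_gt0 (lt_le_trans (a0 k)).
  - split => [x||].
    + rewrite in_itv/= => /andP[ax _]; have [|//] := dsqrt x.
      exact: lt_trans ax.
    + exact/cvg_at_right_filter/csqrt.
    + exact/cvg_at_left_filter/csqrt.
  - move=> x; rewrite in_itv/= => /andP[ax _].
    have xd : is_derive x (1 : R) (fun s : R => 2 * Num.sqrt s) (Num.sqrt x)^-1.
      by apply: dsqrt; exact: lt_trans ax.
    by rewrite derive1E (@derive_val _ _ _ _ _ _ _ xd).
have cvF : (\int[lebesgue_measure]_(s in F k) ((Num.sqrt s)^-1)%:E)%E @[k --> \oo] -->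
    (\int[lebesgue_measure]_(s in \bigcup_k F k) ((Num.sqrt s)^-1)%:E)%E.
  apply: ge0_nondecreasing_set_cvg_integral.
  - apply/nondecreasing_seqP => k; apply/subsetPset => x; rewrite /F /= !in_itv/=.
    move=> /andP[ax ->]; rewrite andbT (le_trans _ ax)// /a ler_pM2l// lef_pV2 ?posrE//.
    by rewrite ler_nat.
  - by move=> k; exact: measurable_itv.
  - move=> k; apply/measurable_EFinP; apply: measurable_inv_sqrt => //.
      exact: measurable_itv.
    by move=> x; rewrite /F /= !in_itv/= andbT => /andP[+ _]; apply: lt_le_trans.
  - by move=> k x _; rewrite lee_fin invr_ge0 sqrtr_ge0.
rewrite -FT -(cvg_lim (@ereal_hausdorff R) cvF); apply: lime_le; first exact: cvgP cvF.
exact: nearW.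
Qed.

Lemma norm_Llog_le f (K M : R) : elip K f -> 0 <= M ->
  {ae gamma, forall x, enorm (gradient f x) <= M} -> (norm_Llog f <= (4 * M)%:E)%E.
Proof.
move=> fK M0 fM; have mf := elip_measurable fK.
apply: ub_ereal_sup => _ /= [t + <-]; rewrite in_itv/= => /andP[t0 t1].
have l0 : 0 < ln (1 / t) by rewrite div1r ln_gt0// invf_gt1.
set r := rearr f t; set l := ln (1 / t) in l0 *.
have sl0 : 0 < Num.sqrt l by rewrite sqrtr_gt0.
have r0 : 0 <= r by exact: rearr_ge0.
pose C := 2 * M * Num.sqrt (t / l).
have C0 : 0 <= C by rewrite !mulr_ge0 ?sqrtr_ge0.
have mI : measurable (`]0%R, t[%classic : set R) by exact: measurable_itv.
have mis : measurable_fun (`]0%R, t[%classic : set R) (fun s : R => (Num.sqrt s)^-1).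
  by apply: measurable_inv_sqrt => // x /=; rewrite !in_itv/= => /andP[->].
have int_le : (\int[lebesgue_measure]_(s in `]0%R, t[) (rearr f s)%:E <=
    (r * t + C * (2 * Num.sqrt t))%:E)%E.
  apply: (@le_trans _ _ (\int[lebesgue_measure]_(s in `]0%R, t[) (r%:E + (C * (Num.sqrt s)^-1)%:E))%E).
    apply: ge0_le_integral => //.
    - by move=> s _; rewrite lee_fin rearr_ge0.
    - by apply/measurable_EFinP; exact: measurable_rearr.
    - apply/measurable_EFinP; apply: measurable_funD => //.
      exact: measurable_funM.
    - move=> s /=; rewrite in_itv/= => /andP[s0 st]; rewrite lee_fin.
      by apply: rearr_elip_le fK M0 fM s0 _; rewrite t0.
  rewrite ge0_integralD//; last 2 first.
  - by move=> s _; rewrite lee_fin mulr_ge0// invr_ge0 sqrtr_ge0.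
  - by apply/measurable_EFinP; exact: measurable_funM.
  rewrite integral_cst//= lebesgue_measure_itv/= lte_fin t0 oppr0 adde0 EFinD EFinM leeD2l//.
  under eq_integral do rewrite EFinM.
  rewrite ge0_integralZl//; last exact/measurable_EFinP.
  apply: (@le_trans _ _ (C%:E * (2 * Num.sqrt t)%:E)%E); last exact: lexx.
  by apply: lee_wpmul2l; [rewrite lee_fin|exact: integral_inv_sqrt_le].
(* Dividing by [t] turns [C * (2 * sqrt t)] into [4 M / sqrt l], since [C = 2 M sqrt (t / l)]. *)
have avg_le : (rearr_avg f t <= (r + 4 * M / Num.sqrt l)%:E)%E.
  rewrite /rearr_avg (le_trans (lee_wpmul2l _ int_le))// ?lee_fin ?invr_ge0 ?(ltW t0)//.
  rewrite le_eqVlt; apply/orP; left; apply/eqP.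
  rewrite /C sqrtrM ?(ltW t0)// sqrtrV ?(ltW l0)//.
  have st : t = Num.sqrt t * Num.sqrt t by rewrite -expr2 sqr_sqrtr// ltW.
  have su : Num.sqrt t != 0 by rewrite gt_eqF// sqrtr_gt0.
  move: st su; move: (Num.sqrt t) => u -> u0.
  by field; rewrite u0 gt_eqF.
rewrite (@le_trans _ _ ((4 * M / Num.sqrt l)%:E * (Num.sqrt l)%:E)%E)//.
  apply: lee_wpmul2r; first by rewrite lee_fin sqrtr_ge0.
  by rewrite EFinN leeBlDl.
by rewrite lee_fin divfK// gt_eqF.
Qed.

Lemma grad_Linfty_ge f (M : R) : grad_Linfty f = M%:E ->
  {ae gamma, forall x, enorm (gradient f x) <= M}.
Proof.
move=> fM; have := ess_sup_inf.ess_sup_ge gamma (abse \o (fun x => (enorm (gradient f x))%:E)).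
have -> : ess_sup_inf.ess_sup gamma (abse \o (fun x => (enorm (gradient f x))%:E)) = M%:E.
  (* The [L^oo] norm is an essential supremum only on a space of positive measure; the Gaussian
     measure has mass one. *)
  rewrite -fM /grad_Linfty unlock /Lnorm; case: ifPn => //.
  by rewrite [X in (_ < X)%E](@probability_setT _ _ _ gamma) lte01.
apply: filterS => x /=; rewrite lee_fin; apply: le_trans; exact: ler_norm.
Qed.

(** * From bounded [norm_Llog] to Gaussian tails *)

Lemma rearr_avg_ge f (t : R) : measurable_fun setT f -> 0 < t ->
  ((rearr f t)%:E <= rearr_avg f t)%E.
Proof.
move=> mf t0.
have le : ((t * rearr f t)%:E <= \int[lebesgue_measure]_(s in `]0%R, t[) (rearr f s)%:E)%E.
  have -> : (t * rearr f t)%:E = (\int[lebesgue_measure]_(s in `]0%R, t[) (rearr f t)%:E)%E.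
    by rewrite integral_cst//= lebesgue_measure_itv/= lte_fin t0 oppr0 adde0 muleC.
  apply: ge0_le_integral => //.
  - by move=> s _; rewrite lee_fin rearr_ge0.
  - by apply/measurable_EFinP; exact: measurable_rearr.
  - move=> s /=; rewrite in_itv/= => /andP[s0 st].
    by rewrite lee_fin nonincreasing_rearr// ltW.
have tn0 : t != 0 by rewrite gt_eqF.
have -> : ((rearr f t)%:E = (t^-1)%:E * (t * rearr f t)%:E)%E by rewrite -EFinM mulKf.
by rewrite /rearr_avg; apply: lee_wpmul2l => //; rewrite lee_fin invr_ge0 ltW.
Qed.

(** On [[t/2, t[] the rearrangement is at least [f^*(t)]. For finite averages this reads [f^**(t/2)
    <= f^**(t) + (f^**(t) - f^*(t))], so the oscillation controls the growth under one halving; the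
    form with sums avoids subtracting infinities. *)
Lemma rearr_avg_half f (t : R) : measurable_fun setT f -> 0 < t ->
  (rearr_avg f (t / 2) + (rearr f t)%:E <= 2%:E * rearr_avg f t)%E.
Proof.
move=> mf t0; have t20 : 0 < t / 2 by rewrite divr_gt0.
have t2t : t / 2 < t by rewrite ltr_pdivrMr// ltr_pMr// ltr1n.
pose I1 : \bar R := (\int[lebesgue_measure]_(s in `]0%R, (t / 2)%R[) (rearr f s)%:E)%E.
have mI : measurable (`[t / 2, t[%classic : set R) by exact: measurable_itv.
have mI1 : measurable (`]0, t / 2[%classic : set R) by exact: measurable_itv.
have U : `]0, t[%classic = `]0, t / 2[%classic `|` `[t / 2, t[%classic :> set R.
  apply/seteqP; split => s /=; rewrite !in_itv/=.
    by move=> /andP[s0 st]; have [h|h] := ltP s (t / 2); [left|right]; rewrite ?s0 ?st ?h.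
  by move=> [/andP[-> /lt_trans->]|/andP[/(lt_le_trans t20)-> ->]].
have mr2 : measurable_fun (`[t / 2, t[%classic : set R) (rearr f).
  have := measurable_rearr (t := t) mf; rewrite U => mr.
  by apply: measurable_funS mr => //; exact: measurableU.
have le : (I1 + (t / 2 * rearr f t)%:E <=
    \int[lebesgue_measure]_(s in `]0%R, t[) (rearr f s)%:E)%E.
  rewrite U ge0_integral_setU//; first last.
  - apply/disj_setPS => s [] /=; rewrite !in_itv/= => /andP[_ h1] /andP[h2 _].
    by have := lt_le_trans h1 h2; rewrite ltxx.
  - by move=> s _; rewrite lee_fin rearr_ge0.
  - by apply/measurable_EFinP; rewrite -U; exact: measurable_rearr.
  apply: leeD => //.
  have -> : (t / 2 * rearr f t)%:E = (\int[lebesgue_measure]_(s in `[(t / 2)%R, t[) (rearr f t)%:E)%E.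
    rewrite integral_cst//= lebesgue_measure_itv/= lte_fin t2t muleC -EFinB -EFinM.
    by congr (_ * _)%:E; field.
  apply: ge0_le_integral => //.
  - by move=> s _; rewrite lee_fin rearr_ge0.
  - exact/measurable_EFinP.
  - move=> s /=; rewrite in_itv/= => /andP[s0 st].
    by rewrite lee_fin nonincreasing_rearr ?(lt_le_trans t20)// ltW.
have I10 : (0 <= I1)%E by apply: integral_ge0 => s _; rewrite lee_fin rearr_ge0.
have t2i0 : (0 <= ((t / 2)^-1)%:E :> \bar R)%E by rewrite lee_fin invr_ge0 ltW.
have := lee_wpmul2l t2i0 le.
rewrite ge0_muleDr ?lee_fin ?mulr_ge0 ?rearr_ge0 ?(ltW t0)//.
rewrite -[((t / 2)^-1%:E * (t / 2 * _)%:E)%E]/(((t / 2)^-1 * (t / 2 * rearr f t))%:E).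
rewrite mulKf ?gt_eqF// -/(rearr_avg f (t / 2)) => /le_trans; apply.
rewrite /rearr_avg muleA le_eqVlt; apply/orP; left; apply/eqP; congr (_ * _)%E.
rewrite -EFinM; congr EFin; field.
by rewrite gt_eqF.
Qed.

(* Along [t = 2^-(k+1)] the averages increase by at most a multiple of
   [1 / sqrt (k+1)] at each halving, hence [f^* (2^-(k+1)) = O(sqrt (k+1))]. *)
Lemma rearr_dyadic_le f : measurable_fun setT f -> (norm_Llog f < +oo)%E ->
  exists2 D : R, 0 < D & forall k, rearr f (2^-1 ^+ k.+1) <= D * Num.sqrt k.+1%:R.
Proof.
move=> mf fB.
have [b [b0 bP]] : exists b : R, 0 <= b /\ (norm_Llog f <= b%:E)%E.
  case: (norm_Llog f) fB => [r _||]//.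
    by exists (Num.max 0 r); rewrite le_max lexx/= lee_fin le_max lexx orbT.
  by exists 0; rewrite leNye.
have main (t : R) : 0 < t < 1 ->
    ((rearr_avg f t - (rearr f t)%:E) * (Num.sqrt (ln (1 / t)))%:E <= b%:E)%E.
  move=> t01; apply: le_trans bP; apply: ereal_sup_ubound; exists t => //.
pose T k : R := 2^-1 ^+ k.+1.
have T01 k : 0 < T k < 1 by rewrite exprn_gt0 ?invr_gt0//= exprn_ilt1// invf_lt1// ltr1n.
have T0 k : 0 < T k by case/andP: (T01 k).
have ln20 : 0 < ln 2 :> R by rewrite ln_gt0// ltr1n.
have lnT k : ln (1 / T k) = ln 2 * k.+1%:R.
  by rewrite /T div1r -exprVn invrK lnXn// mulr_natr.
have l0 k : 0 < Num.sqrt (ln (1 / T k)) by rewrite sqrtr_gt0 lnT mulr_gt0.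
(* An infinite average would make the product bounded in [main] equal to [+oo]. *)
have avg_fin k : rearr_avg f (T k) \is a fin_num.
  have := rearr_avg_ge mf (T0 k); have := main _ (T01 k).
  case: (rearr_avg f (T k)) => //=.
  by rewrite gt0_mulye ?lte_fin.
pose A k := fine (rearr_avg f (T k)).
have AE k : rearr_avg f (T k) = (A k)%:E by rewrite /A fineK.
have Ar k : A k - rearr f (T k) <= b / Num.sqrt (ln (1 / T k)).
  by have := main _ (T01 k); rewrite AE -EFinB -EFinM lee_fin ler_pdivlMr.
have Ahalf k : A k.+1 + rearr f (T k) <= 2 * A k.
  have := rearr_avg_half mf (T0 k).
  by rewrite (_ : T k / 2 = T k.+1) ?AE -?EFinD -?EFinM ?lee_fin// /T [RHS]exprSr.
pose b' := b / Num.sqrt (ln 2).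
have b'0 : 0 <= b' by rewrite divr_ge0 ?sqrtr_ge0.
have bE k : b / Num.sqrt (ln (1 / T k)) = b' / Num.sqrt k.+1%:R.
  by rewrite lnT sqrtrM ?(ltW ln20)// invfM mulrA.
have A00 : 0 <= A 0%N.
  have := rearr_avg_ge mf (T0 0%N); rewrite AE lee_fin; apply: le_trans; exact: rearr_ge0.
(* [A 0] starts the induction, [1] makes [D] positive, and [3 * b'] pays for one halving: with
   [u = sqrt (k+1)] and [v = sqrt (k+2)], [(v - u) (v + u) = 1] and [v <= 2 u] give
   [1 / u <= 3 (v - u)]. *)
pose D := A 0%N + 3 * b' + 1.
have D0 : 0 < D by rewrite ltr_wpDl// addr_ge0// mulr_ge0.
have AD k : A k <= D * Num.sqrt k.+1%:R.
  elim: k => [|k IH]; first by rewrite sqrtr1 mulr1 /D -addrA lerDl addr_ge0// mulr_ge0.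
  have := Ahalf k; have := Ar k; rewrite bE.
  set u := Num.sqrt k.+1%:R in IH *; set v := Num.sqrt k.+2%:R.
  have u0 : 0 < u by rewrite sqrtr_gt0.
  have v0 : 0 < v by rewrite sqrtr_gt0.
  have uv : v ^+ 2 = u ^+ 2 + 1 by rewrite !sqr_sqrtr// natr1.
  have u1 : 1 <= u by rewrite -sqrtr1 ler_sqrt// ler1n.
  have v2u : v <= 2 * u.
    rewrite -(ler_pXn2r (n := 2)) ?nnegrE ?mulr_ge0 ?(ltW u0) ?(ltW v0)// uv exprMn.
    have : 1 <= u ^+ 2 by rewrite expr_ge1// ltW.
    lra.
  have key : b' / u <= D * (v - u).
    rewrite ler_pdivrMr// (@le_trans _ _ (3 * b' * ((v - u) * u)))//.
      have : 1 <= 3 * ((v - u) * u) by nra.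
      by move=> /(ler_wpM2l b'0); rewrite mulr1; lra.
    have vu0 : 0 <= (v - u) * u.
      rewrite mulr_ge0 ?(ltW u0)// subr_ge0 -(ler_pXn2r (n := 2)) ?nnegrE ?(ltW u0) ?(ltW v0)// uv.
      by rewrite lerDl.
    by rewrite -[leRHS]mulrA ler_wpM2r// /D; lra.
  lra.
exists D => // k; apply: le_trans (AD k).
by have := rearr_avg_ge mf (T0 k); rewrite AE lee_fin.
Qed.

Lemma sum_geometric_le k : \sum_(i < k) (3 / 4) ^+ i <= 4 :> R.
Proof.
suff -> : \sum_(i < k) (3 / 4) ^+ i = 4 - 4 * (3 / 4) ^+ k :> R.
  by rewrite gerBl mulr_ge0// exprn_ge0// divr_ge0.
elim: k => [|k IH]; first by rewrite big_ord0 expr0 mulr1 subrr.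
by rewrite big_ord_recr/= IH exprS; field.
Qed.

Lemma Llog_expL2 : (@Llog R n) `<=` (@expL2 R n).
Proof.
move=> f [intf fB]; have mf : measurable_fun setT f.
  by apply/measurable_EFinP; exact: measurable_int intf.
split => //; have [D0 D00 rD] := rearr_dyadic_le mf fB.
(* Both gaps serve strict inequalities: [D0 < D] for [rearr_lt], and [D < D'] to place the points
   with [f^2 >= D'^2 (k+1)] in [E k]. *)
pose D := D0 + 1; pose D' := D + 1.
have D'0 : 0 < D' by rewrite /D' /D; lra.
have sk k : 0 < Num.sqrt k.+1%:R :> R by rewrite sqrtr_gt0.
pose E k := [set x | D * Num.sqrt k.+1%:R < `|f x|].
have mE k : measurable (E k) by exact: measurable_superlevel.
have gE k : (gamma (E k) <= (2^-1 ^+ k.+1)%:E)%E.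
  have T0 : 0 < 2^-1 ^+ k.+1 :> R by rewrite exprn_gt0 ?invr_gt0.
  apply: rearr_lt => //.
  by apply: (le_lt_trans (rD k)); rewrite ltr_pM2r// /D ltrDl.
(* Any [q] strictly between [1] and [2] would serve: [q > 1] makes [lam] positive, and [q < 2] makes
   the series of ratio [q / 2] converge against the dyadic tails. *)
pose q : R := 3 / 2.
have q0 : 0 < q by rewrite divr_gt0.
have q1 : 1 < q by rewrite /q; lra.
have lnq : 0 < ln q by rewrite ln_gt0.
pose lam := ln q / D' ^+ 2.
exists lam; first by rewrite divr_gt0// exprn_gt0.
have elam (x : 'rV[R]_n) k : `|f x| ^+ 2 <= D' ^+ 2 * k%:R -> expR (lam * f x ^+ 2) <= q ^+ k.
  move=> fk; rewrite -[q in leRHS]lnK ?posrE// -expRM_natl ler_expR /lam.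
  rewrite -[f x ^+ 2]real_normK ?num_real// mulrAC ler_pdivrMr ?exprn_gt0//.
  by rewrite [leRHS]mulrAC mulrC ler_pM2r// [leRHS]mulrC.
(* If [j] is the integer part of [f^2 / D'^2], the exponential is at most [q^(j+1)]: the constant
   term covers [j = 0], and for [j = k + 1] the point lies in [E k], whose term is [q^(k+2)]. *)
pose F (x : 'rV[R]_n) : \bar R := (q%:E + \sum_(k <oo) (q ^+ k.+2 * \1_(E k) x)%:E)%E.
have eF x : ((expR (lam * f x ^+ 2))%:E <= F x)%E.
  pose y := `|f x| ^+ 2 / D' ^+ 2.
  have y0 : 0 <= y by rewrite divr_ge0 ?exprn_ge0// ltW.
  have /andP[jy yj] := truncn_itv y0.
  have fj : `|f x| ^+ 2 <= D' ^+ 2 * (Num.truncn y).+1%:R.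
    by rewrite mulrC -ler_pdivrMr ?exprn_gt0// ltW.
  have := elam x _ fj; case: (Num.truncn y) jy => [|k] jy ek.
    apply: (@le_trans _ _ q%:E); first by rewrite lee_fin.
    by rewrite /F leeDl// nneseries_ge0// => k _ _; rewrite lee_fin mulr_ge0 ?exprn_ge0 ?(ltW q0).
  have xE : E k x.
    rewrite /E /= -(ltr_pXn2r (n := 2)) ?nnegrE ?mulr_ge0 ?(ltW (sk k))//; last by rewrite /D; lra.
    rewrite exprMn sqr_sqrtr// (@lt_le_trans _ _ (D' ^+ 2 * k.+1%:R))//.
      by rewrite ltr_pM2r// ltrXn2r// ?nnegrE /D' /D; lra.
    by rewrite mulrC -ler_pdivlMr ?exprn_gt0.
  have u0 i : (0 <= (q ^+ i.+2 * \1_(E i) x)%:E :> \bar R)%E.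
    by rewrite lee_fin mulr_ge0 ?exprn_ge0 ?(ltW q0).
  apply: (@le_trans _ _ (q ^+ k.+2 * \1_(E k) x)%:E).
    by rewrite lee_fin indicE mem_set// mulr1.
  rewrite /F (@le_trans _ _ (\sum_(k <oo) (q ^+ k.+2 * \1_(E k) x)%:E)%E)//; last first.
    by rewrite leeDr// lee_fin ltW.
  rewrite (le_trans _ (nneseries_lim_ge k.+1 _))//.
  by rewrite big_nat_recr//= leeDr// sume_ge0.
have mF : measurable_fun setT (fun x => \sum_(k <oo) (q ^+ k.+2 * \1_(E k) x)%:E)%E.
  apply: ge0_emeasurable_sum => [k x _ _|k _].
    by rewrite lee_fin mulr_ge0 ?exprn_ge0 ?(ltW q0).
  by apply/measurable_EFinP; apply: measurable_funM => //; exact: measurable_indic.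
have F0 x : (0 <= \sum_(k <oo) (q ^+ k.+2 * \1_(E k) x)%:E :> \bar R)%E.
  by apply: nneseries_ge0 => k _ _; rewrite lee_fin mulr_ge0 ?exprn_ge0 ?(ltW q0).
apply: (@le_lt_trans _ _ (\int[gamma]_x F x)%E).
  apply: ge0_le_integral => //.
  - apply/measurable_EFinP; apply: measurableT_comp => //.
    by apply: measurable_funM => //; exact: measurable_funX.
  - exact: emeasurable_funD.
rewrite ge0_integralD//; last by move=> x _; rewrite lee_fin ltW.
rewrite integral_nneseries//; first last.
- by move=> k x _; rewrite lee_fin mulr_ge0 ?exprn_ge0 ?(ltW q0).
- by move=> k; apply/measurable_EFinP; apply: measurable_funM => //; exact: measurable_indic.
have intE k : (\int[gamma]_x (q ^+ k.+2 * \1_(E k) x)%:E = (q ^+ k.+2)%:E * gamma (E k))%E.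
  under eq_integral do rewrite EFinM.
  rewrite ge0_integralZl ?integral_indic ?setIT//; first exact/measurable_EFinP.
  by rewrite lee_fin exprn_ge0 ?ltW.
rewrite integral_cst// [X in (_ * X)%E](@probability_setT _ _ _ gamma) mule1.
under eq_eseriesr do rewrite intE.
apply: (@le_lt_trans _ _ (q%:E + (q ^+ 2 / 2 * 4)%:E)%E); last by rewrite -EFinD ltry.
rewrite leeD2l//; apply: lime_le.
  by apply: is_cvg_nneseries => k _ _; rewrite mule_ge0// lee_fin exprn_ge0 ?ltW.
apply: nearW => m.
apply: (@le_trans _ _ (\sum_(0 <= i < m) (q ^+ 2 / 2 * (3 / 4) ^+ i)%:E)%E).
  apply: lee_sum => k _; apply: (@le_trans _ _ ((q ^+ k.+2)%:E * (2^-1 ^+ k.+1)%:E)%E).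
    by apply: lee_wpmul2l => //; rewrite lee_fin exprn_ge0 ?ltW.
  rewrite -EFinM lee_fin le_eqVlt; apply/orP; left; apply/eqP.
  have -> : 3 / 4 = q * 2^-1 :> R by rewrite /q; field.
  have e (u v : R) : u ^+ k.+2 * v ^+ k.+1 = u ^+ 2 * v * (u * v) ^+ k.
    by rewrite exprMn !exprS expr0; ring.
  exact: e.
rewrite sumEFin lee_fin -mulr_sumr big_mkord ler_wpM2l ?sum_geometric_le//.
by rewrite divr_ge0 ?exprn_ge0 ?ltW.
Qed.

End rearrangement.

Theorem mainTheorem5 (R : realType) :
  (exists2 c : R, 0 < c &
     forall (n : nat) (f : 'rV[R]_n -> R), (1 <= n)%N -> elipschitz f ->
       (norm_Llog f <= c%:E * grad_Linfty f)%E) /\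
  (forall n : nat, (1 <= n)%N ->
     (Llog : set ('rV[R]_n -> R)) `<=` expL2).
Proof.
split; last by move=> n _; exact: Llog_expL2.
exists 4 => // n f _ [K fK].
have : (0 <= grad_Linfty f)%E by exact: Lnorm_ge0.
case fM : (grad_Linfty f) => [M||] // M0; last by rewrite gt0_muley ?leey// lte_fin.
rewrite -EFinM; apply: norm_Llog_le fK _ _; first by rewrite -lee_fin.
exact: grad_Linfty_ge.
Qed.
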